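(* Let $\lambda>0$ and $1\le\nu<2$. The solution $u_\nu$ of $\frac{\partial^{\nu}u}{\partial t^{\nu}}=\lambda^2\frac{\partial^2u}{\partial x^2}$, $x\in\mathbb{R}$, $t>0$, with $u(x,0)=\delta(x)$, $u_t(x,0)=0$, satisfies \[ u_\nu(x,t)=\frac2\nu\,\frac{1}{2\lambda t^{\nu/2}}\,p_{2/\nu}\!\left(\frac{|x|}{\lambda t^{\nu/2}};\frac2\nu(\nu-1),1\right)=\frac1\nu\,p_{2/\nu}\!\left(|x|;\frac2\nu(\nu-1),\lambda^{2/\nu}t\right). \]
   Context: Fractional derivative in the Dzherbashyan–Caputo sense: for $1<\nu<2$, $\frac{\partial^{\nu}u}{\partial t^{\nu}}(x,t)=\frac{1}{\Gamma(2-\nu)}\int_0^t (t-s)^{1-\nu}\frac{\partial^2 u}{\partial s^2}(x,s)\,ds$; for $\nu=1$ the ordinary first derivative (the condition $u_t(x,0)=0$ being then the one stated). The solution is $u_\nu(x,t)=\frac{1}{2\lambda t^{\nu/2}}\sum_{k\ge0}\frac{(-|x|/(\lambda t^{\nu/2}))^k}{k!\,\Gamma(-\nu k/2+1-\nu/2)}$. For $\alpha\neq1$, the stable density is $p_\alpha(x;\gamma,\eta)=\frac{1}{2\pi}\int_{-\infty}^{+\infty}e^{-i\beta x}\exp\{-\eta|\beta|^\alpha e^{-i\frac{\pi\gamma}{2}\frac{\beta}{|\beta|}}\}\,d\beta$. *)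

(* Defs.v *)
From Stdlib Require Import Reals Factorial.
From Coquelicot Require Import Coquelicot.
Open Scope R_scope.

Fixpoint rising (z : R) (n : nat) : R :=
  match n with
  | O => z
  | S m => rising z m * (z + INR (S m))
  end.

(* Reciprocal Gamma function 1/Gamma(z), for every real z, via Gauss's formula
   Gamma(z) = lim n! n^z / (z (z+1) ... (z+n)); it vanishes at z = 0,-1,-2,... *)
Definition rgamma (z : R) : R :=
  Lim_seq (fun n => rising z n / (INR (Factorial.fact n) * Rpower (INR n) z)).

Definition u_sol (lam nu x t : R) : R :=
  / (2 * lam * Rpower t (nu / 2)) *
  Series (fun k : nat =>
    (- Rabs x / (lam * Rpower t (nu / 2))) ^ k / INR (Factorial.fact k)
    * rgamma (- nu * INR k / 2 + 1 - nu / 2)).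

Definition cexp (z : C) : C :=
  (exp (Re z) * cos (Im z), exp (Re z) * sin (Im z)).

Definition abspow (b a : R) : R :=
  if Req_EM_T b 0 then 0 else Rpower (Rabs b) a.

(* b / |b| (sign of b); its value at 0 is irrelevant for the integral *)
Definition sgn (b : R) : R :=
  if Req_EM_T b 0 then 0 else b / Rabs b.

Definition stable_density (alpha x gam eta : R) : C :=
  Cmult (RtoC (/ (2 * PI)))
  (RInt_gen (V := C_R_CompleteNormedModule)
    (fun b : R =>
       Cmult (cexp (0, - b * x))
       (cexp (Copp (Cmult (RtoC (eta * abspow b alpha))
                   (cexp (0, - (PI * gam / 2) * sgn b))))))
    (Rbar_locally m_infty) (Rbar_locally p_infty)).

(* Main.v *)
(* Put alpha = 2 / nu and theta = PI gamma / 2 = PI - PI alpha / 2, which lies in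
   [0, PI / 2). The density is (1 / PI) times the real part of the integral of
   exp (- i b x - eta b^alpha e^(- i theta)) over b > 0. Because alpha > 1, the power
   series of exp (- i b x) may be integrated term by term; the k-th moment is, by
   rotating the ray of integration through theta, a phase times
   eta^(- s) Gamma (s) / alpha with s = (k + 1) / alpha. Its real part produces
   Gamma (s) sin (PI s) / PI, which Euler's reflection formula turns into 1 / Gamma (1 - s).
   Reflection follows from Gauss's limit for Gamma and Euler's product for the sine.
   All half-line integrals are written in the variable y with b = exp y, which makes
   every integrand smooth on the whole line. *)

Require Import Defs.
From Stdlib Require Import Reals Lra Lia Factorial.
From Coquelicot Require Import Coquelicot.
Open Scope R_scope.

(** * Euler's Gamma integral *)

(** Contour integration is replaced by a real argument. Up to a constant factor, the integrand along
    a ray depends on [al * y + l - i th] alone, so its derivative in the angle is an exact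
    derivative in [y]. A truncated integral therefore changes with the angle only through its two
    end values, which tend to 0 while [cos th > 0]. Both [th < PI / 2] and [alpha > 1] amount to
    [nu < 2]. The second lets the decay absorb exp (2 X b); since z^N / N! <= 2^(-N) exp (2 z), the
    Taylor remainder then leaves an error of order 2^(-N), uniform over all truncated intervals.
    This yields convergence of the series and of the integral at once. Reflection must also hold
    where [1 - s] is zero or negative, outside the reach of the integral [Gam]. Hence only [Gam s]
    with [s > 0] enters, and 1 / Gamma (1 - s) is read off Gauss's sequence in [rgamma]. The
    imaginary part needs no value, only a convergent integral: the two half-lines cancel it. *)

Notation is_RInt_line f l :=
  (is_RInt_gen f (Rbar_locally m_infty) (Rbar_locally p_infty) l).

Lemma filter_prod_infty_le (c d : R) :
  filter_prod (Rbar_locally m_infty) (Rbar_locally p_infty)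
    (fun ab : R * R => fst ab < c /\ d < snd ab).
Proof.
apply Filter_prod with (fun a => a < c) (fun b => d < b).
- now exists c.
- now exists d.
- now intros a b ? ?; split.
Qed.

Lemma is_RInt_line_ext (f g : R -> R) (l : R) :
  (forall y, f y = g y) -> is_RInt_line f l -> is_RInt_line g l.
Proof.
intros H; apply is_RInt_gen_ext.
apply filter_forall; intros ab x _; apply H.
Qed.

Lemma is_RInt_line_derive (F f : R -> R) (la lb : R) :
  (forall y, is_derive F y (f y)) -> (forall y, continuous f y) ->
  is_lim F m_infty la -> is_lim F p_infty lb -> is_RInt_line f (lb - la).
Proof.
intros dF cf Ha Hb.
assert (E : forall y, Derive F y = f y) by (intros y; now apply is_derive_unique).
apply is_RInt_line_ext with (Derive F); [exact E|].
apply is_RInt_gen_Derive; try assumption.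
- apply filter_forall; intros ab x _; now exists (f x).
- apply filter_forall; intros ab x _.
  apply continuous_ext with f; [now intros y; rewrite E | apply cf].
Qed.

Lemma is_RInt_line_abs_le (f g : R -> R) (lf lg : R) :
  (forall y, Rabs (f y) <= g y) ->
  is_RInt_line f lf -> is_RInt_line g lg -> Rabs lf <= lg.
Proof.
intros H Hf Hg.
refine (RInt_gen_norm (V := R_CompleteNormedModule) f g lf lg _ _ Hf Hg).
- generalize (filter_prod_infty_le 0 0); apply filter_imp; intros ab; lra.
- apply filter_forall; intros ab x _; apply H.
Qed.

Lemma is_RInt_line_le (f g : R -> R) (lf lg : R) :
  (forall y, 0 <= f y <= g y) ->
  is_RInt_line f lf -> is_RInt_line g lg -> lf <= lg.
Proof.
intros H Hf Hg; apply Rle_trans with (1 := Rle_abs _).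
apply is_RInt_line_abs_le with (2 := Hf) (3 := Hg).
intros y; rewrite Rabs_pos_eq; apply H.
Qed.

Lemma ex_RInt_continuous_all (f : R -> R) (a b : R) :
  (forall y, continuous f y) -> ex_RInt f a b.
Proof. intros cf; apply (ex_RInt_continuous (V := R_CompleteNormedModule)); auto. Qed.

(** The absolute value on the right makes the bound valid for either order of the endpoints, as the
    Cauchy criterion requires. *)
Lemma abs_RInt_le_antiderivative (f Phi phi : R -> R) (a b : R) :
  (forall y, continuous f y) ->
  (forall y, is_derive Phi y (phi y)) -> (forall y, continuous phi y) ->
  (forall y, Rabs (f y) <= phi y) ->
  Rabs (RInt f a b) <= Rabs (Phi b - Phi a).
Proof.
intros cf dP cp H.
assert (main : forall u v, u <= v -> Rabs (RInt f u v) <= Phi v - Phi u).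
{ intros u v uv.
  refine (norm_RInt_le (V := R_NormedModule) f phi u v _ _ uv (fun x _ => H x) _ _).
  - apply (RInt_correct (V := R_CompleteNormedModule)); now apply ex_RInt_continuous_all.
  - apply (is_RInt_derive (V := R_CompleteNormedModule)); auto. }
destruct (Rle_dec a b) as [ab|ab].
- apply Rle_trans with (2 := Rle_abs _); now apply main.
- rewrite <- (opp_RInt_swap (V := R_CompleteNormedModule)) by now apply ex_RInt_continuous_all.
  unfold opp; simpl; rewrite Rabs_Ropp, Rabs_minus_sym.
  apply Rle_trans with (2 := Rle_abs _); apply main; lra.
Qed.

(** Continuity makes every truncated integral exist, so the relational limit in [is_RInt_gen]
    becomes the limit of a function, to which the Cauchy criterion applies. *)
Lemma is_RInt_line_filterlim (f : R -> R) (l : R) :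
  (forall y, continuous f y) ->
  is_RInt_line f l <->
  filterlim (fun ab : R * R => RInt f (fst ab) (snd ab))
    (filter_prod (Rbar_locally m_infty) (Rbar_locally p_infty)) (locally l).
Proof.
intros cf; split; intros H P HP.
- generalize (H P HP); unfold filtermap, filtermapi; apply filter_imp.
  intros ab [z [Hz Pz]].
  now rewrite (is_RInt_unique (V := R_CompleteNormedModule) _ _ _ _ Hz).
- generalize (H P HP); unfold filtermap, filtermapi; apply filter_imp.
  intros ab Pz; exists (RInt f (fst ab) (snd ab)); split; [|exact Pz].
  apply (RInt_correct (V := R_CompleteNormedModule)); now apply ex_RInt_continuous_all.
Qed.

Lemma ex_RInt_line_dominated (f Phi phi : R -> R) (la lb : R) :
  (forall y, continuous f y) ->
  (forall y, is_derive Phi y (phi y)) -> (forall y, continuous phi y) ->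
  (forall y, Rabs (f y) <= phi y) ->
  is_lim Phi m_infty la -> is_lim Phi p_infty lb ->
  exists l : R, is_RInt_line f l.
Proof.
intros cf dP cp H Ha Hb.
cut (exists l : R_CompleteSpace, filterlim (fun ab : R * R => RInt f (fst ab) (snd ab))
    (filter_prod (Rbar_locally m_infty) (Rbar_locally p_infty)) (locally l)).
{ intros [l Hl]; exists l; now apply is_RInt_line_filterlim. }
apply filterlim_locally_cauchy; intros eps.
(* At each end two values of [Phi] lie within eps / 4 of the same limit, hence within eps / 2 of
   each other; the two ends add up to eps. *)
assert (e4 : 0 < eps / 4) by (generalize (cond_pos eps); lra).
pose (e := mkposreal _ e4).
exists (fun ab => ball la e (Phi (fst ab)) /\ ball lb e (Phi (snd ab))); split.
- apply Filter_prod with (fun a => ball la e (Phi a)) (fun b => ball lb e (Phi b)).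
  + apply Ha; now exists e.
  + apply Hb; now exists e.
  + now intros.
- intros [a b] [a' b']; simpl; intros [h1 h2] [h3 h4].
  change (Rabs (RInt f a' b' - RInt f a b) < eps).
  change (Rabs (Phi a - la) < eps / 4) in h1.
  change (Rabs (Phi b - lb) < eps / 4) in h2.
  change (Rabs (Phi a' - la) < eps / 4) in h3.
  change (Rabs (Phi b' - lb) < eps / 4) in h4.
  assert (e1 : RInt f a' b' = RInt f a' a + RInt f a b + RInt f b b').
  { rewrite <- (RInt_Chasles (V := R_CompleteNormedModule) f a' a b') by now apply ex_RInt_continuous_all.
    rewrite <- (RInt_Chasles (V := R_CompleteNormedModule) f a b b') by now apply ex_RInt_continuous_all.
    unfold plus; simpl; ring. }
  rewrite e1.
  replace (RInt f a' a + RInt f a b + RInt f b b' - RInt f a b)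
    with (RInt f a' a + RInt f b b') by ring.
  apply Rle_lt_trans with (1 := Rabs_triang _ _).
  generalize (abs_RInt_le_antiderivative f Phi phi a' a cf dP cp H).
  generalize (abs_RInt_le_antiderivative f Phi phi b b' cf dP cp H).
  apply Rabs_def2 in h1; apply Rabs_def2 in h2; apply Rabs_def2 in h3; apply Rabs_def2 in h4.
  assert (Rabs (Phi b' - Phi b) < eps / 2) by (apply Rabs_def1; lra).
  assert (Rabs (Phi a - Phi a') < eps / 2) by (apply Rabs_def1; lra).
  lra.
Qed.

Lemma continuous_of_derive (f : R -> R) :
  (forall y, ex_derive f y) -> forall y, continuous f y.
Proof. intros H y; now apply (ex_derive_continuous (V := R_NormedModule)). Qed.

Lemma is_lim_exp_affine_m (p q : R) : 0 < p -> is_lim (fun y => exp (p * y + q)) m_infty 0.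
Proof.
intros p0.
apply (is_lim_comp exp (fun y => p * y + q) m_infty 0 m_infty).
- apply is_lim_exp_m.
- apply is_lim_ext with (fun y => p * y + q); [easy|].
  eapply is_lim_plus; [|apply is_lim_const|].
  + apply is_lim_scal_l; apply is_lim_id.
  + simpl. destruct (Rle_dec 0 p) as [h|h]; [destruct (Rle_lt_or_eq_dec 0 p h)|]; try lra; easy.
- now exists 0.
Qed.

Lemma is_lim_exp_affine_p (p q : R) : p < 0 -> is_lim (fun y => exp (p * y + q)) p_infty 0.
Proof.
intros p0.
apply (is_lim_comp exp (fun y => p * y + q) p_infty 0 m_infty).
- apply is_lim_exp_m.
- eapply is_lim_plus; [|apply is_lim_const|].
  + apply is_lim_scal_l; apply is_lim_id.
  + simpl. destruct (Rle_dec 0 p) as [h|h]; [destruct (Rle_lt_or_eq_dec 0 p h)|]; try lra; easy.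
- now exists 0.
Qed.

(** By convexity the right side stays above its tangent; [y0] is the point where [c * exp (al * y)]
    has slope [K]. *)
Lemma exp_exp_dominates_linear (c al K : R) :
  0 < c -> 0 < al -> 0 < K ->
  exists M, forall y, K * y <= c * exp (al * y) + M.
Proof.
intros c0 al0 K0.
pose (y0 := ln (K / (c * al)) / al).
exists (K * y0); intros y.
assert (h : c * exp (al * y0) * al = K).
{ unfold y0; replace (al * (ln (K / (c * al)) / al)) with (ln (K / (c * al))) by (field; lra).
  rewrite exp_ln; [field; lra|]. apply Rdiv_lt_0_compat; [lra|now apply Rmult_lt_0_compat]. }
replace (al * y) with (al * y0 + al * (y - y0)) by ring.
rewrite exp_plus.
generalize (exp_ineq1_le (al * (y - y0))).
assert (0 < c * exp (al * y0)) by (apply Rmult_lt_0_compat; [easy|apply exp_pos]).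
intros h2; apply (Rmult_le_compat_l (c * exp (al * y0))) in h2; [|lra].
rewrite <- h; nra.
Qed.

Lemma exp_le (x y : R) : x <= y -> exp x <= exp y.
Proof. intros [H | ->]; [now apply Rlt_le, exp_increasing | apply Rle_refl]. Qed.

Lemma is_lim_exp_exp (p c al : R) (z : Rbar) :
  0 < p -> 0 < c -> 0 < al -> z = m_infty \/ z = p_infty ->
  is_lim (fun y => exp (p * y - c * exp (al * y))) z 0.
Proof.
intros p0 c0 al0 [-> | ->].
- apply is_lim_le_le_loc with (fun _ => 0) (fun y => exp (p * y + 0)).
  + apply filter_forall; intros y; split; [apply Rlt_le, exp_pos|].
    apply exp_le; generalize (exp_pos (al * y)); nra.
  + apply is_lim_const.
  + now apply is_lim_exp_affine_m.
(* Slope [p + 1] pays for the growth of [exp (p * y)] and leaves the majorant [exp (- y + M)]. *)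
- destruct (exp_exp_dominates_linear c al (p + 1) c0 al0) as [M HM]; [lra|].
  apply is_lim_le_le_loc with (fun _ => 0) (fun y => exp (- (1) * y + M)).
  + apply filter_forall; intros y; split; [apply Rlt_le, exp_pos|].
    apply exp_le; generalize (HM y); lra.
  + apply is_lim_const.
  + apply is_lim_exp_affine_p; lra.
Qed.

(* The substitution [t = exp y] in Euler's integral of [t ^ (s - 1) * exp (- t)]. *)
Definition gamma_kernel (s y : R) : R := exp (s * y - exp y).

Definition Gam (s : R) : R :=
  RInt_gen (V := R_CompleteNormedModule) (gamma_kernel s) (Rbar_locally m_infty) (Rbar_locally p_infty).

Lemma gamma_kernel_continuous (s y : R) : continuous (gamma_kernel s) y.
Proof. apply continuous_of_derive; intros z; unfold gamma_kernel; auto_derive; auto. Qed.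

Lemma is_lim_gamma_kernel (s : R) (z : Rbar) :
  0 < s -> z = m_infty \/ z = p_infty -> is_lim (gamma_kernel s) z 0.
Proof.
intros s0 hz.
apply is_lim_ext with (fun y => exp (s * y - 1 * exp (1 * y))).
- intros y; unfold gamma_kernel; now rewrite !Rmult_1_l.
- apply is_lim_exp_exp; try lra; easy.
Qed.

Lemma is_RInt_line_unique (f : R -> R) (l : R) :
  is_RInt_line f l ->
  RInt_gen (V := R_CompleteNormedModule) f (Rbar_locally m_infty) (Rbar_locally p_infty) = l.
Proof. intros H; now apply (is_RInt_gen_unique (V := R_CompleteNormedModule)). Qed.

(** Integration by parts: the derivative of [gamma_kernel s] is [s * gamma_kernel s - gamma_kernel
    (s + 1)], and the end values vanish. *)
Lemma is_RInt_line_gamma_kernel_succ (s l : R) :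
  0 < s -> is_RInt_line (gamma_kernel s) l -> is_RInt_line (gamma_kernel (s + 1)) (s * l).
Proof.
intros s0 Hl.
assert (D : is_RInt_line (fun y => s * gamma_kernel s y - gamma_kernel (s + 1) y) (0 - 0)).
{ apply is_RInt_line_derive with (gamma_kernel s).
  - intros y; unfold gamma_kernel; auto_derive; auto.
    unfold Rminus; replace ((s + 1) * y + - exp y) with ((s * y + - exp y) + y) by ring.
    rewrite (exp_plus _ y); ring.
  - intros y; apply (continuous_minus (V := R_NormedModule)).
    + apply (continuous_scal_r (V := R_NormedModule)); apply gamma_kernel_continuous.
    + apply gamma_kernel_continuous.
  - apply is_lim_gamma_kernel; auto.
  - apply is_lim_gamma_kernel; auto. }
replace (s * l) with (minus (scal s l) (0 - 0)) by (unfold minus, plus, scal, opp; simpl; unfold mult; simpl; ring).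
apply is_RInt_line_ext with
  (fun y => minus (scal s (gamma_kernel s y)) (s * gamma_kernel s y - gamma_kernel (s + 1) y)).
- intros y; unfold minus, plus, scal, opp; simpl; unfold mult; simpl; ring.
- apply (is_RInt_gen_minus (V := R_NormedModule)); [|exact D].
  now apply (is_RInt_gen_scal (V := R_NormedModule)).
Qed.

Lemma ex_gamma_kernel_integral (s : R) : 0 < s -> exists l : R, is_RInt_line (gamma_kernel s) l.
Proof.
intros s0.
assert (main : forall n s, 0 < s <= INR n + 1 -> exists l : R, is_RInt_line (gamma_kernel s) l).
{ clear s s0; intros n; induction n as [|n IH]; intros s [s0 sn].
  - simpl in sn.
    (* For [s <= 1] this majorant has an explicit antiderivative. It rests on [exp (s * y) <= exp y]
       for [y >= 0]; the factor [exp 1] pays for negative [y], where [exp (s * y) <= 1]. Larger [s]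
       follow from the recurrence. *)
    apply (ex_RInt_line_dominated _ (fun y => - (exp 1 / s) * exp (- exp (s * y)))
      (fun y => exp 1 * (exp (s * y) * exp (- exp (s * y)))) (- (exp 1 / s)) 0).
    + apply gamma_kernel_continuous.
    + intros y; auto_derive; auto; field; lra.
    + apply continuous_of_derive; intros y; auto_derive; auto.
    + intros y; unfold gamma_kernel; rewrite Rabs_pos_eq by apply Rlt_le, exp_pos.
      rewrite <- !exp_plus; apply exp_le.
      destruct (Rle_dec 0 y) as [y0|y0].
      * assert (exp (s * y) <= exp y) by (apply exp_le; nra). lra.
      * assert (exp (s * y) <= exp 0) by (apply exp_le; nra).
        rewrite exp_0 in H; generalize (exp_pos y); lra.
    + replace (Finite (- (exp 1 / s))) with (Rbar_mult (- (exp 1 / s)) 1) by (simpl; f_equal; ring).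
      apply is_lim_scal_l.
      apply (is_lim_comp exp (fun y => - exp (s * y)) m_infty 1 0).
      * rewrite <- exp_0; apply is_lim_continuity, derivable_continuous_pt, derivable_pt_exp.
      * replace (Finite 0) with (Rbar_opp 0) by (simpl; f_equal; ring).
        apply is_lim_opp. 
        apply is_lim_ext with (fun y => exp (s * y + 0)); [intros y; now rewrite Rplus_0_r|].
        now apply is_lim_exp_affine_m.
      * exists 0; intros y _ H; injection H; generalize (exp_pos (s * y)); lra.
    + replace (Finite 0) with (Rbar_mult (- (exp 1 / s)) 0) by (simpl; f_equal; ring).
      apply is_lim_scal_l.
      apply (is_lim_comp exp (fun y => - exp (s * y)) p_infty 0 m_infty).
      * apply is_lim_exp_m.
      * apply (is_lim_opp (fun y => exp (s * y)) p_infty p_infty).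
        apply (is_lim_comp exp (fun y => s * y) p_infty p_infty p_infty).
        -- apply is_lim_exp_p.
        -- replace p_infty with (Rbar_mult s p_infty) at 2.
           apply is_lim_scal_l, is_lim_id.
           simpl; destruct (Rle_dec 0 s) as [h|h]; [destruct (Rle_lt_or_eq_dec 0 s h)|]; try lra; easy.
        -- now exists 0.
      * now exists 0.
  - destruct (Rle_dec s (INR n + 1)) as [h|h].
    + apply IH; lra.
    + rewrite S_INR in sn.
      assert (0 < s - 1) by (generalize (pos_INR n); lra).
      destruct (IH (s - 1)) as [l Hl]; [lra|].
      exists ((s - 1) * l); replace s with (s - 1 + 1) at 1 by ring.
      now apply is_RInt_line_gamma_kernel_succ. }
destruct (nfloor_ex s) as [n Hn]; [lra|].
apply (main n); lra.
Qed.

Lemma Gam_correct (s : R) : 0 < s -> is_RInt_line (gamma_kernel s) (Gam s).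
Proof.
intros s0; destruct (ex_gamma_kernel_integral s s0) as [l Hl].
unfold Gam; now rewrite (is_RInt_line_unique _ _ Hl).
Qed.

Lemma Gam_succ (s : R) : 0 < s -> Gam (s + 1) = s * Gam s.
Proof.
intros s0; unfold Gam at 1; apply is_RInt_line_unique.
apply is_RInt_line_gamma_kernel_succ; [easy | now apply Gam_correct].
Qed.

Lemma Gam_1 : Gam 1 = 1.
Proof.
unfold Gam; apply is_RInt_line_unique; replace 1 with (0 - - 1) at 2 by ring.
apply is_RInt_line_derive with (fun y => - exp (- exp y)).
- intros y; unfold gamma_kernel.
  replace (exp (1 * y - exp y)) with (exp y * exp (- exp y)) by (rewrite <- exp_plus; f_equal; ring).
  auto_derive; auto; ring.
- apply gamma_kernel_continuous.
- apply (is_lim_opp (fun y => exp (- exp y)) m_infty 1).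
  apply (is_lim_comp exp (fun y => - exp y) m_infty 1 0).
  + rewrite <- exp_0; apply is_lim_continuity, derivable_continuous_pt, derivable_pt_exp.
  + replace (Finite 0) with (Rbar_opp 0) by (simpl; f_equal; ring).
    apply is_lim_opp, is_lim_exp_m.
  + exists 0; intros y _ H; injection H; generalize (exp_pos y); lra.
- replace (Finite 0) with (Rbar_opp 0) by (simpl; f_equal; ring).
  apply (is_lim_opp (fun y => exp (- exp y)) p_infty 0).
  apply (is_lim_comp exp (fun y => - exp y) p_infty 0 m_infty).
  + apply is_lim_exp_m.
  + apply (is_lim_opp exp p_infty p_infty), is_lim_exp_p.
  + now exists 0.
Qed.

Lemma Gam_fact (n : nat) : Gam (INR n + 1) = INR (fact n).
Proof.
induction n as [|n IH].
- simpl; rewrite Rplus_0_l; apply Gam_1.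
- rewrite S_INR, Gam_succ, IH by (generalize (pos_INR n); lra).
  rewrite fact_simpl, mult_INR, S_INR; ring.
Qed.

(** * The reflection formula *)

(** The exponential lies above its tangent at [r * z]; the values of that tangent at 0 and [z],
    weighted by [1 - r] and [r], average to [exp (r * z)]. *)
Lemma exp_chord (r z : R) : 0 <= r <= 1 -> exp (r * z) <= 1 - r + r * exp z.
Proof.
intros hr.
generalize (exp_ineq1_le (z - r * z)) (exp_ineq1_le (- (r * z))); intros h1 h2.
assert (h3 : 1 <= r * exp (z - r * z) + (1 - r) * exp (- (r * z))) by nra.
apply (Rmult_le_compat_l (exp (r * z))) in h3; [|apply Rlt_le, exp_pos].
assert (e1 : exp (r * z) * exp (z - r * z) = exp z) by (rewrite <- exp_plus; f_equal; ring).
assert (e2 : exp (r * z) * exp (- (r * z)) = 1) by (rewrite <- exp_plus, <- exp_0; f_equal; ring).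
nra.
Qed.

Lemma gamma_kernel_shift (p r y : R) : gamma_kernel (p + r) y = exp (r * y) * gamma_kernel p y.
Proof. unfold gamma_kernel; rewrite <- exp_plus; f_equal; ring. Qed.

(** A substitute for the log-convexity of Gamma. The chord bound for [exp (r * (y - ln N))] leaves
    only the kernels at [p] and [p + 1]; the free scale [N] is later taken to be n, close to [p], so
    that the last factor is nearly 1. *)
Lemma Gam_interpolation (p r N : R) : 0 < p -> 0 <= r <= 1 -> 0 < N ->
  Gam (p + r) <= Rpower N r * Gam p * (1 - r + r * p / N).
Proof.
intros p0 hr N0.
replace (Rpower N r * Gam p * (1 - r + r * p / N))
  with (plus (scal (Rpower N r * (1 - r)) (Gam p)) (scal (Rpower N r * r / N) (Gam (p + 1)))).
2: { rewrite Gam_succ by easy; unfold plus, scal; simpl; unfold mult; simpl; field; lra. }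
apply is_RInt_line_le with (2 := Gam_correct (p + r) ltac:(lra)) (f := gamma_kernel (p + r))
  (g := fun y => plus (scal (Rpower N r * (1 - r)) (gamma_kernel p y)) (scal (Rpower N r * r / N) (gamma_kernel (p + 1) y))).
- intros y; split; [apply Rlt_le, exp_pos|].
  rewrite !gamma_kernel_shift.
  unfold plus, scal; simpl; unfold mult; simpl.
  assert (h : exp (r * y) <= Rpower N r * (1 - r + r * (exp y / N))).
  { replace (exp (r * y)) with (Rpower N r * exp (r * (y - ln N))).
    2: { unfold Rpower; rewrite <- exp_plus; f_equal; ring. }
    apply Rmult_le_compat_l; [apply Rlt_le, exp_pos|].
    replace (exp y / N) with (exp (y - ln N)); [now apply exp_chord|].
    unfold Rminus; rewrite exp_plus, exp_Ropp, exp_ln by easy; reflexivity. }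
  apply (Rmult_le_compat_r (gamma_kernel p y)) in h; [|apply Rlt_le, exp_pos].
  apply Rle_trans with (1 := h); right; rewrite Rmult_1_l; field; lra.
- apply (is_RInt_gen_plus (V := R_NormedModule)); apply (is_RInt_gen_scal (V := R_NormedModule));
    apply Gam_correct; lra.
Qed.

(** * Gauss's limit for the Gamma integral *)

Definition gauss_ratio (s : R) (n : nat) : R :=
  Gam (s + INR n + 1) / (INR (fact n) * Rpower (INR n) s).

Lemma gauss_ratio_bounds (s : R) (n : nat) : 0 < s <= 1 -> (0 < n)%nat ->
  1 <= gauss_ratio s n <= 1 + / INR n.
Proof.
intros hs hn; assert (n0 : 0 < INR n) by now apply lt_0_INR.
assert (F := INR_fact_lt_0 n).
assert (P0 : 0 < Rpower (INR n) s) by apply exp_pos.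
assert (Q0 : 0 < Rpower (INR n) (1 - s)) by apply exp_pos.
assert (PQ : Rpower (INR n) s * Rpower (INR n) (1 - s) = INR n).
{ rewrite <- Rpower_plus; replace (s + (1 - s)) with 1 by ring; now apply Rpower_1. }
assert (FP : 0 < INR (fact n) * Rpower (INR n) s) by now apply Rmult_lt_0_compat.
(* The first inequality climbs from n + 1 to n + 1 + s and bounds the ratio above; the second climbs
   from s + n + 1 to n + 2 and bounds it below. *)
generalize (Gam_interpolation (INR n + 1) s (INR n)) (Gam_interpolation (s + INR n + 1) (1 - s) (INR n)).
intros h1 h2.
specialize (h1 ltac:(lra) ltac:(lra) ltac:(lra)).
specialize (h2 ltac:(lra) ltac:(lra) ltac:(lra)).
rewrite Gam_fact in h1.
replace (s + INR n + 1 + (1 - s)) with (INR n + 1 + 1) in h2 by ring.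
rewrite Gam_succ, Gam_fact in h2 by lra.
replace (INR n + 1 + s) with (s + INR n + 1) in h1 by ring.
unfold gauss_ratio; set (g := Gam (s + INR n + 1)) in *; split.
- apply Rmult_le_reg_r with (1 := FP); unfold Rdiv; rewrite Rmult_assoc, Rinv_l, Rmult_1_l, Rmult_1_r by lra.
  assert (i0 : 0 < / INR n) by now apply Rinv_0_lt_compat.
  (* Positivity is forced by [h2]: its left side is positive and the last factor on its right is
     nonnegative. *)
  assert (g0 : 0 < Rpower (INR n) (1 - s) * g).
  { destruct (Rlt_dec 0 (Rpower (INR n) (1 - s) * g)) as [|h]; [easy|exfalso].
    assert (0 < (INR n + 1) * INR (fact n)) by (apply Rmult_lt_0_compat; lra).
    assert (0 <= 1 - (1 - s) + (1 - s) * (s + INR n + 1) / INR n).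
    { assert (0 <= (1 - s) * (s + INR n + 1)) by (apply Rmult_le_pos; lra).
      assert (0 <= (1 - s) * (s + INR n + 1) * / INR n) by (apply Rmult_le_pos; lra). 
      unfold Rdiv; lra. }
    nra. }
  (* After multiplication by n the two sides differ by exactly [s ^ 2]. *)
  assert (h3 : 1 - (1 - s) + (1 - s) * (s + INR n + 1) / INR n <= (INR n + 1) / INR n).
  { apply Rmult_le_reg_r with (1 := n0).
    replace ((1 - (1 - s) + (1 - s) * (s + INR n + 1) / INR n) * INR n)
      with (s * INR n + (1 - s) * (s + INR n + 1)) by (field; lra).
    replace ((INR n + 1) / INR n * INR n) with (INR n + 1) by (field; lra). nra. }
  assert (h4 : (INR n + 1) * INR (fact n) <= Rpower (INR n) (1 - s) * g * ((INR n + 1) / INR n)).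
  { apply Rle_trans with (1 := h2); apply Rmult_le_compat_l; lra. }
  assert (h5 : INR (fact n) * INR n <= Rpower (INR n) (1 - s) * g).
  { apply Rmult_le_reg_r with ((INR n + 1) / INR n).
    - apply Rdiv_lt_0_compat; lra.
    - apply Rle_trans with (2 := h4); right; field; lra. }
  apply Rmult_le_reg_l with (1 := Q0).
  apply Rle_trans with (2 := h5); right; rewrite <- PQ at 3; ring.
- apply Rmult_le_reg_r with (1 := FP); unfold Rdiv; rewrite Rmult_assoc, Rinv_l, Rmult_1_r by lra.
  apply Rle_trans with (1 := h1).
  rewrite (Rmult_comm _ (INR (fact n))), Rmult_comm; apply Rmult_le_compat_r; [lra|].
  replace (1 - s + s * (INR n + 1) / INR n) with (1 + s * / INR n) by (field; lra).
  assert (0 < / INR n) by now apply Rinv_0_lt_compat.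
  nra.
Qed.

Lemma is_lim_seq_inv_INR : is_lim_seq (fun n => / INR n) 0.
Proof.
apply (is_lim_seq_inv INR p_infty); [apply is_lim_seq_INR | easy].
Qed.

(** The ratio equals [Gam s] times [rising s n] / (n! n^s), so limit 1 is Gauss's formula for [Gam].
    The bounds squeeze it for [s <= 1]; passing from [s - 1] to [s] multiplies it by [1 + s / n]. *)
Lemma is_lim_gauss_ratio (s : R) : 0 < s -> is_lim_seq (gauss_ratio s) 1.
Proof.
intros s0.
assert (main : forall m s, 0 < s <= INR m + 1 -> is_lim_seq (gauss_ratio s) 1).
{ clear s s0; intros m; induction m as [|m IH]; intros s [s0 sm].
  - simpl in sm.
    apply is_lim_seq_le_le_loc with (fun _ => 1) (fun n => 1 + / INR n).
    + exists 1%nat; intros n hn; apply gauss_ratio_bounds; [lra|lia].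
    + apply is_lim_seq_const.
    + replace (Finite 1) with (Finite (1 + 0)) by (f_equal; ring).
      apply is_lim_seq_plus'; [apply is_lim_seq_const | apply is_lim_seq_inv_INR].
  - destruct (Rle_dec s (INR m + 1)) as [h|h]; [apply IH; lra|].
    rewrite S_INR in sm; assert (s1 : 0 < s - 1) by (generalize (pos_INR m); lra).
    apply is_lim_seq_ext_loc with (fun n => (1 + s * / INR n) * gauss_ratio (s - 1) n).
    + exists 1%nat; intros n hn; assert (n0 : 0 < INR n) by (apply lt_0_INR; lia).
      unfold gauss_ratio.
      replace (s + INR n + 1) with (s - 1 + INR n + 1 + 1) by ring.
      rewrite (Gam_succ (s - 1 + INR n + 1)) by lra.
      replace (Rpower (INR n) s) with (Rpower (INR n) (s - 1) * INR n).
      2: { transitivity (Rpower (INR n) (s - 1) * Rpower (INR n) 1); [now rewrite Rpower_1|].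
           rewrite <- Rpower_plus; f_equal; ring. }
      assert (F := INR_fact_lt_0 n).
      assert (0 < Rpower (INR n) (s - 1)) by apply exp_pos.
      field; repeat split; lra.
    + replace (Finite 1) with (Finite ((1 + s * 0) * 1)) by (f_equal; ring).
      apply is_lim_seq_mult'; [|apply IH; lra].
      apply is_lim_seq_plus'; [apply is_lim_seq_const|].
      apply is_lim_seq_mult'; [apply is_lim_seq_const | apply is_lim_seq_inv_INR]. }
destruct (nfloor_ex s) as [m Hm]; [lra|].
apply (main m); lra.
Qed.

(** [rising s n] has n + 1 factors, hence the argument [s + INR n + 1]. *)
Lemma rising_Gam (s : R) (n : nat) : 0 < s -> rising s n * Gam s = Gam (s + INR n + 1).
Proof.
intros s0; induction n as [|n IH].
- simpl; rewrite Rplus_0_r; symmetry; now apply Gam_succ.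
- change (rising s (S n)) with (rising s n * (s + INR (S n))); rewrite S_INR.
  replace (s + (INR n + 1) + 1) with (s + INR n + 1 + 1) by ring.
  rewrite (Gam_succ (s + INR n + 1)) by (generalize (pos_INR n); lra).
  rewrite <- IH. ring.
Qed.

(** * Euler's product for the sine, from cosine moments *)

Definition cos_moment (z : R) (m : nat) : R :=
  RInt (fun t => cos (2 * z * t) * cos t ^ m) 0 (PI / 2).

Lemma ex_RInt_of_derive (f : R -> R) (a b : R) : (forall t, ex_derive f t) -> ex_RInt f a b.
Proof. intros H; apply ex_RInt_continuous_all; now apply continuous_of_derive. Qed.

Lemma is_RInt_cos_moment (z : R) (m : nat) :
  is_RInt (fun t => cos (2 * z * t) * cos t ^ m) 0 (PI / 2) (cos_moment z m).
Proof.
apply (RInt_correct (V := R_CompleteNormedModule)), ex_RInt_of_derive.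
intros t; auto_derive; auto.
Qed.

(** Two integrations by parts. Comparing this recurrence at [z] with the one at 0 is what produces
    the factors 1 - z^2 / n^2 of Euler's product. *)
Lemma cos_moment_succ (z : R) (m : nat) :
  ((INR m + 2) ^ 2 - 4 * z ^ 2) * cos_moment z (S (S m)) =
  (INR m + 2) * (INR m + 1) * cos_moment z m.
Proof.
(* [W] collects the boundary terms of both integrations by parts; it vanishes at 0 through the sines
   and at PI / 2 through the powers of the cosine. *)
pose (W := fun t => (INR m + 2) * (cos (2 * z * t) * cos t ^ S m * sin t)
             - 2 * z * (sin (2 * z * t) * cos t ^ S (S m))).
pose (w := fun t => ((INR m + 2) ^ 2 - 4 * z ^ 2) * (cos (2 * z * t) * cos t ^ S (S m))
                    - (INR m + 2) * (INR m + 1) * (cos (2 * z * t) * cos t ^ m)).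
assert (H : is_RInt w 0 (PI / 2) (minus (W (PI / 2)) (W 0))).
{ apply (is_RInt_derive (V := R_CompleteNormedModule)).
  - intros t _; unfold W, w; auto_derive; auto.
    change (match m with O => 1 | S _ => INR m + 1 end) with (INR (S m)); rewrite S_INR.
    generalize (sin2_cos2 t); unfold Rsqr; intros h.
    assert (h' : sin t * sin t = 1 - cos t * cos t) by lra.
    simpl pow.
    generalize dependent (sin t); intros s _ h'.
    ring_simplify; replace (s ^ 2) with (1 - cos t * cos t) by (rewrite <- h'; ring); ring.
  - intros t _; apply continuous_of_derive; intros u; unfold w; auto_derive; auto. }
assert (W0 : minus (W (PI / 2)) (W 0) = 0).
{ unfold minus, plus, opp, W; simpl; replace (2 * z * 0) with 0 by ring.
  rewrite cos_PI2, sin_0; ring. }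
rewrite W0 in H.
assert (H' := is_RInt_minus (V := R_NormedModule) _ _ _ _ _ _
  (is_RInt_scal (V := R_NormedModule) _ _ _ ((INR m + 2) ^ 2 - 4 * z ^ 2) _ (is_RInt_cos_moment z (S (S m))))
  (is_RInt_scal (V := R_NormedModule) _ _ _ ((INR m + 2) * (INR m + 1)) _ (is_RInt_cos_moment z m))).
apply (is_RInt_unique (V := R_CompleteNormedModule)) in H.
apply (is_RInt_unique (V := R_CompleteNormedModule)) in H'.
change (RInt w 0 (PI / 2) = minus (scal ((INR m + 2) ^ 2 - 4 * z ^ 2) (cos_moment z (S (S m))))
  (scal ((INR m + 2) * (INR m + 1)) (cos_moment z m))) in H'.
rewrite H in H'; unfold minus, plus, opp, scal in H'; simpl in H'; unfold mult in H'; simpl in H'.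
simpl; lra.
Qed.

Lemma cos_moment_0 (z : R) : 2 * z * cos_moment z 0 = sin (PI * z).
Proof.
assert (H : is_RInt (fun t => 2 * z * (cos (2 * z * t) * cos t ^ 0)) 0 (PI / 2)
  (minus (sin (2 * z * (PI / 2))) (sin (2 * z * 0)))).
{ apply (is_RInt_derive (V := R_CompleteNormedModule) (fun t => sin (2 * z * t))).
  - intros t _; auto_derive; auto; simpl; ring.
  - intros t _; apply continuous_of_derive; intros u; auto_derive; auto. }
assert (H' := is_RInt_scal (V := R_NormedModule) _ _ _ (2 * z) _ (is_RInt_cos_moment z 0)).
apply (is_RInt_unique (V := R_CompleteNormedModule)) in H.
apply (is_RInt_unique (V := R_CompleteNormedModule)) in H'.
change (RInt (fun t => 2 * z * (cos (2 * z * t) * cos t ^ 0)) 0 (PI / 2) = 2 * z * cos_moment z 0) in H'.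
rewrite <- H', H, Rmult_0_r, sin_0; unfold minus, plus, opp; simpl.
rewrite Ropp_0, Rplus_0_r; f_equal; field.
Qed.

Lemma cos_moment_00 : cos_moment 0 0 = PI / 2.
Proof.
unfold cos_moment.
rewrite (RInt_ext (V := R_CompleteNormedModule) _ (fun _ => 1)).
- rewrite (RInt_const (V := R_CompleteNormedModule)); unfold scal; simpl; unfold mult; simpl; ring.
- intros t _; replace (2 * 0 * t) with 0 by ring; rewrite cos_0; simpl; ring.
Qed.

Lemma cos_moment_pos (n : nat) : 0 < cos_moment 0 (2 * n).
Proof.
induction n as [|n IH].
- change (2 * 0)%nat with 0%nat; rewrite cos_moment_00; generalize PI_RGT_0; lra.
- replace (2 * S n)%nat with (S (S (2 * n))) by lia.
  generalize (cos_moment_succ 0 (2 * n)) (pos_INR (2 * n)); intros h m0.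
  assert (h2 : 0 < (INR (2 * n) + 2) * (INR (2 * n) + 1) * cos_moment 0 (2 * n))
    by (apply Rmult_lt_0_compat; [nra|easy]).
  rewrite <- h in h2; apply Rmult_lt_reg_l with ((INR (2 * n) + 2) ^ 2 - 4 * 0 ^ 2).
  + nra.
  + now rewrite Rmult_0_r.
Qed.

Lemma mul_cos_le_sin (t : R) : 0 <= t <= PI / 2 -> t * cos t <= sin t.
Proof.
intros ht.
pose (f := fun u => sin u - u * cos u).
destruct (MVT_gen f 0 t (fun u => u * sin u)) as [c [hc e]].
- intros u _; unfold f; auto_derive; auto; ring.
- intros u _; apply continuity_pt_filterlim.
  apply (continuous_of_derive f); intros v; unfold f; auto_derive; auto.
- rewrite Rmin_left, Rmax_right in hc by lra.
  unfold f in e; rewrite sin_0 in e.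
  assert (0 <= sin c) by (apply sin_ge_0; generalize PI_RGT_0; lra).
  assert (0 <= c * sin c * (t - 0)) by (apply Rmult_le_pos; [apply Rmult_le_pos|]; lra).
  lra.
Qed.

Lemma one_minus_cos_le (u : R) : 0 <= 1 - cos u <= u ^ 2 / 2.
Proof.
split; [generalize (COS_bound u); lra|].
replace u with (2 * (u / 2)) at 1 by field.
rewrite cos_2a_sin.
assert (h : Rabs (sin (u / 2)) <= Rabs (u / 2)).
{ destruct (MVT_gen sin 0 (u / 2) cos) as [c [_ e]].
  - intros x _; auto_derive; auto; ring.
  - intros x _; apply continuity_sin.
  - rewrite sin_0, !Rminus_0_r in e; rewrite e, Rabs_mult.
    rewrite <- (Rmult_1_l (Rabs (u / 2))) at 2.
    apply Rmult_le_compat_r; [apply Rabs_pos|apply Rabs_le, COS_bound]. }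
apply Rsqr_le_abs_1 in h; unfold Rsqr in h; lra.
Qed.

(** Pointwise, 1 - cos (2 z t) <= 2 z^2 t^2, and [t * cos t <= sin t] trades t^2 cos^2 t for sin^2 t
    = 1 - cos^2 t, which integrates to the difference of two moments. *)
Lemma cos_moment_dist (z : R) (m : nat) :
  Rabs (cos_moment z (S (S m)) - cos_moment 0 (S (S m))) <=
  2 * z ^ 2 * (cos_moment 0 m - cos_moment 0 (S (S m))).
Proof.
assert (P := PI_RGT_0).
refine (norm_RInt_le (V := R_NormedModule)
  (fun t => minus (cos (2 * z * t) * cos t ^ S (S m)) (cos (2 * 0 * t) * cos t ^ S (S m)))
  (fun t => scal (2 * z ^ 2) (minus (cos (2 * 0 * t) * cos t ^ m) (cos (2 * 0 * t) * cos t ^ S (S m))))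
  0 (PI / 2) (minus (cos_moment z (S (S m))) (cos_moment 0 (S (S m))))
  (scal (2 * z ^ 2) (minus (cos_moment 0 m) (cos_moment 0 (S (S m))))) _ _ _ _).
- lra.
- intros t ht; replace (2 * 0 * t) with 0 by ring; rewrite cos_0.
  unfold minus, plus, opp, scal, norm; simpl; unfold mult, abs; simpl.
  assert (c0 : 0 <= cos t) by (apply cos_ge_0; lra).
  assert (p0 : 0 <= cos t ^ m) by now apply pow_le.
  generalize (one_minus_cos_le (2 * z * t)) (mul_cos_le_sin t ht) (sin2_cos2 t); unfold Rsqr; intros h1 h2 h3.
  replace (cos (2 * z * t) * (cos t * (cos t * cos t ^ m)) + - (1 * (cos t * (cos t * cos t ^ m))))
    with (- ((1 - cos (2 * z * t)) * (cos t * (cos t * cos t ^ m)))) by ring.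
  rewrite Rabs_Ropp, Rabs_pos_eq.
  2: { repeat apply Rmult_le_pos; lra. }
  apply Rle_trans with ((2 * z * t) ^ 2 / 2 * (cos t * (cos t * cos t ^ m))).
  + apply Rmult_le_compat_r; [repeat apply Rmult_le_pos; lra|lra].
  + replace ((2 * z * t) ^ 2 / 2 * (cos t * (cos t * cos t ^ m)))
      with (2 * (z * (z * 1)) * cos t ^ m * ((t * cos t) * (t * cos t))) by field.
    replace (1 * cos t ^ m + - (1 * (cos t * (cos t * cos t ^ m))))
      with (cos t ^ m * (sin t * sin t)).
    2: { replace (sin t * sin t) with (1 - cos t * cos t) by lra; ring. }
    rewrite (Rmult_assoc _ (cos t ^ m)).
    apply Rmult_le_compat_l; [nra|].
    apply Rmult_le_compat_l; [easy|].
    apply Rmult_le_compat; try easy; apply Rmult_le_pos; lra.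
- apply (is_RInt_minus (V := R_NormedModule)); apply is_RInt_cos_moment.
- apply (is_RInt_scal (V := R_NormedModule)).
  apply (is_RInt_minus (V := R_NormedModule)); apply is_RInt_cos_moment.
Qed.

Fixpoint euler_prod (z : R) (n : nat) : R :=
  match n with
  | O => 1
  | S m => euler_prod z m * (1 - z ^ 2 / INR (S m) ^ 2)
  end.

(** Induction with the recurrences at [z] and at 0. The form without division also covers integer
    [z], where a factor of the product vanishes. *)
Lemma euler_prod_cos_moment (z : R) (n : nat) :
  PI * z * euler_prod z n * cos_moment z (2 * n) = sin (PI * z) * cos_moment 0 (2 * n).
Proof.
induction n as [|n IH].
- change (2 * 0)%nat with 0%nat; rewrite cos_moment_00, <- cos_moment_0; simpl; field.
- change (euler_prod z (S n)) with (euler_prod z n * (1 - z ^ 2 / INR (S n) ^ 2)).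
  generalize (cos_moment_succ 0 (2 * n)) (cos_moment_succ z (2 * n)).
  replace (2 * S n)%nat with (S (S (2 * n))) by lia.
  rewrite mult_INR; change (INR 2) with 2; rewrite S_INR; assert (n0 := pos_INR n).
  set (u := cos_moment z (S (S (2 * n)))); set (v := cos_moment 0 (S (S (2 * n)))).
  intros h1 h2.
  apply Rmult_eq_reg_l with ((2 * INR n + 2) ^ 2); [|nra].
  transitivity (PI * z * euler_prod z n * (((2 * INR n + 2) ^ 2 - 4 * z ^ 2) * u)).
  { field; lra. }
  rewrite h2.
  transitivity ((2 * INR n + 2) * (2 * INR n + 1) * (PI * z * euler_prod z n * cos_moment z (2 * n))); [ring|].
  rewrite IH.
  transitivity (sin (PI * z) * ((2 * INR n + 2) * (2 * INR n + 1) * cos_moment 0 (2 * n))); [ring|].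
  rewrite <- h1; ring.
Qed.

(** At [z = 0] the recurrence makes the gap between consecutive even moments a fraction 1 / (2 n +
    1) of the later one, so [cos_moment_dist] puts the ratio within 2 z^2 / (2 n + 1) of 1. *)
Lemma is_lim_cos_moment_ratio (z : R) :
  is_lim_seq (fun n => cos_moment z (2 * n) / cos_moment 0 (2 * n)) 1.
Proof.
apply is_lim_seq_incr_1.
apply is_lim_seq_ext with (fun n => 1 + (cos_moment z (2 * S n) / cos_moment 0 (2 * S n) - 1)).
{ intros n; ring. }
replace (Finite 1) with (Finite (1 + 0)) by (f_equal; ring).
apply is_lim_seq_plus'; [apply is_lim_seq_const|].
apply is_lim_seq_abs_0.
apply is_lim_seq_le_le_loc with (fun _ => 0) (fun n => 2 * z ^ 2 * / INR n).
- exists 1%nat; intros n hn; split; [apply Rabs_pos|].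
  assert (n0 : 0 < INR n) by (apply lt_0_INR; lia).
  generalize (cos_moment_dist z (2 * n)) (cos_moment_pos (S n)) (cos_moment_succ 0 (2 * n)).
  replace (2 * S n)%nat with (S (S (2 * n))) by lia.
  rewrite mult_INR; change (INR 2) with 2.
  set (u := cos_moment z (S (S (2 * n)))); set (v := cos_moment 0 (S (S (2 * n)))).
  intros h1 v0 h2.
  assert (h3 : cos_moment 0 (2 * n) - v = v / (2 * INR n + 1)).
  { apply Rmult_eq_reg_l with ((2 * INR n + 2) * (2 * INR n + 1)); [|nra].
    rewrite Rmult_minus_distr_l, <- h2; field; lra. }
  rewrite h3 in h1.
  replace (u / v - 1) with ((u - v) / v) by (field; lra).
  unfold Rdiv; rewrite Rabs_mult, Rabs_inv, (Rabs_pos_eq v) by lra.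
  apply Rmult_le_reg_r with (1 := v0).
  rewrite Rmult_assoc, Rinv_l, Rmult_1_r by lra.
  apply Rle_trans with (1 := h1).
  rewrite (Rmult_assoc (2 * z ^ 2)); apply Rmult_le_compat_l; [nra|].
  unfold Rdiv; rewrite Rmult_comm; apply Rmult_le_compat_r; [lra|].
  apply Rinv_le_contravar; lra.
- apply is_lim_seq_const.
- replace (Finite 0) with (Finite (2 * z ^ 2 * 0)) by (f_equal; ring).
  apply is_lim_seq_mult'; [apply is_lim_seq_const | apply is_lim_seq_inv_INR].
Qed.

Lemma is_lim_euler_prod (z : R) :
  is_lim_seq (fun n => z * euler_prod z n) (sin (PI * z) / PI).
Proof.
assert (P := PI_RGT_0).
pose (q := fun n => cos_moment z (2 * n) / cos_moment 0 (2 * n)).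
assert (Q : is_lim_seq q 1) by exact (is_lim_cos_moment_ratio z).
apply is_lim_seq_ext_loc with (fun n => sin (PI * z) / PI / q n).
- assert (Q' := Q (fun y => 0 < y)); destruct Q' as [N HN].
  { exists (mkposreal 1 Rlt_0_1); intros y hy; change (Rabs (y - 1) < 1) in hy; apply Rabs_def2 in hy; lra. }
  exists N; intros n hn; specialize (HN n hn).
  assert (c0 := cos_moment_pos n); assert (e := euler_prod_cos_moment z n).
  assert (E : z * euler_prod z n * q n = sin (PI * z) / PI).
  { apply Rmult_eq_reg_l with (PI * cos_moment 0 (2 * n)); [|apply Rgt_not_eq, Rmult_lt_0_compat; lra].
    transitivity (PI * z * euler_prod z n * cos_moment z (2 * n)).
    - unfold q; field; lra.
    - rewrite e; field; lra. }
  rewrite <- E; field; lra.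
- replace (Finite (sin (PI * z) / PI)) with (Finite (sin (PI * z) / PI / 1)) by (f_equal; field; lra).
  apply is_lim_seq_div'; [apply is_lim_seq_const|easy|lra].
Qed.

(** Pairing the factors k + s and k - s gives k^2 (1 - s^2 / k^2); the unpaired ones are [s] and the
    last, n + 1 - s. *)
Lemma rising_reflection (s : R) (n : nat) :
  rising s n * rising (1 - s) n =
  s * euler_prod s n * INR (fact n) ^ 2 * (INR n + 1 - s).
Proof.
induction n as [|n IH]; [simpl; ring|].
change (rising s (S n)) with (rising s n * (s + INR (S n))).
change (rising (1 - s) (S n)) with (rising (1 - s) n * (1 - s + INR (S n))).
change (euler_prod s (S n)) with (euler_prod s n * (1 - s ^ 2 / INR (S n) ^ 2)).
rewrite fact_simpl, mult_INR, S_INR.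
transitivity (rising s n * rising (1 - s) n * (s + (INR n + 1)) * (1 - s + (INR n + 1))); [ring|].
rewrite IH; assert (n0 := pos_INR n); field; lra.
Qed.

(** Only [s] has to be positive: [1 - s] may be any real below 1, poles of Gamma included, since the
    left side is computed from its defining sequence. *)
Lemma rgamma_reflection (s : R) : 0 < s -> rgamma (1 - s) = Gam s * (sin (PI * s) / PI).
Proof.
intros s0; assert (P := PI_RGT_0).
cut (is_lim_seq (fun n => rising (1 - s) n / (INR (fact n) * Rpower (INR n) (1 - s)))
       (Gam s * (sin (PI * s) / PI))).
{ intros H; unfold rgamma; now rewrite (is_lim_seq_unique _ _ H). }
assert (G := is_lim_gauss_ratio s s0).
(* The sequence of [rgamma (1 - s)] is the product from [rising_reflection] over n!^2 n, divided by
   [rising s n] / (n! n^s), which is [gauss_ratio s n / Gam s]. The last factor (n + 1 - s) / n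
   becomes [1 + (1 - s) * / INR n]. *)
apply is_lim_seq_ext_loc with
  (fun n => Gam s * (s * euler_prod s n) * (1 + (1 - s) * / INR n) / gauss_ratio s n).
- destruct (G (fun y => 0 < y)) as [N HN].
  { exists (mkposreal 1 Rlt_0_1); intros y hy; change (Rabs (y - 1) < 1) in hy; apply Rabs_def2 in hy; lra. }
  exists (N + 1)%nat; intros n hn; specialize (HN n ltac:(lia)).
  assert (n0 : 0 < INR n) by (apply lt_0_INR; lia).
  assert (F := INR_fact_lt_0 n).
  assert (P0 : 0 < Rpower (INR n) s) by apply exp_pos.
  assert (Q0 : 0 < Rpower (INR n) (1 - s)) by apply exp_pos.
  assert (PQ : Rpower (INR n) s * Rpower (INR n) (1 - s) = INR n).
  { rewrite <- Rpower_plus; replace (s + (1 - s)) with 1 by ring; now apply Rpower_1. }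
  assert (rG := rising_Gam s n s0); assert (rr := rising_reflection s n).
  apply Rmult_eq_reg_r with (gauss_ratio s n); [|lra].
  transitivity (Gam s * (s * euler_prod s n) * (1 + (1 - s) * / INR n)); [field; lra|].
  unfold gauss_ratio; rewrite <- rG.
  transitivity (Gam s * (rising s n * rising (1 - s) n) /
    (INR (fact n) ^ 2 * (Rpower (INR n) s * Rpower (INR n) (1 - s)))).
  + rewrite rr, PQ; field; lra.
  + field; repeat split; lra.
- replace (Finite (Gam s * (sin (PI * s) / PI)))
    with (Finite (Gam s * (sin (PI * s) / PI) * (1 + (1 - s) * 0) / 1)) by (f_equal; field; lra).
  apply is_lim_seq_div'; [|exact G|lra].
  apply is_lim_seq_mult'.
  + apply is_lim_seq_mult'; [apply is_lim_seq_const | apply is_lim_euler_prod].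
  + apply is_lim_seq_plus'; [apply is_lim_seq_const|].
    apply is_lim_seq_mult'; [apply is_lim_seq_const | apply is_lim_seq_inv_INR].
Qed.

(** * Rotation of the ray of integration *)

Lemma is_RInt_line_comp_lin (f : R -> R) (u v l : R) :
  0 < u -> is_RInt_line f l -> is_RInt_line (fun y => u * f (u * y + v)) l.
Proof.
intros u0 H P HP.
destruct (H P HP) as [Q1 Q2 [A HA] [B HB] HQ].
apply Filter_prod with (fun y => y < (A - v) / u) (fun y => (B - v) / u < y).
- now exists ((A - v) / u).
- now exists ((B - v) / u).
- intros a b ha hb.
  destruct (HQ (u * a + v) (u * b + v)) as [z [Hz Pz]].
  + apply HA; apply (Rmult_lt_compat_l u) in ha; [|easy].
    replace (u * ((A - v) / u)) with (A - v) in ha by (field; lra); lra.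
  + apply HB; apply (Rmult_lt_compat_l u) in hb; [|easy].
    replace (u * ((B - v) / u)) with (B - v) in hb by (field; lra); lra.
  + exists z; split; [|exact Pz].
    now apply (is_RInt_comp_lin (V := R_NormedModule)).
Qed.

(* Real part, up to the phase [phi], of [z ^ (p / al) * exp (- z)] along the ray
   [z = exp (al * y + l) * exp (- i th)], as a function of [y]. *)
Definition ray (al l p phi th y : R) : R :=
  exp (p * y - cos th * exp (al * y + l)) *
  cos (phi - p / al * th + sin th * exp (al * y + l)).

(** Let F be the complex function with real part [ray]; it is holomorphic in w = al * y + l - i th,
    up to a constant factor. Then dF/dth = -i F'(w) and dF/dy = al F'(w), so dF/dth is the
    y-derivative of -i F / al, whose real part Im F / al is this function. *)
Definition ray_primitive (al l p phi th y : R) : R :=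
  / al * (exp (p * y - cos th * exp (al * y + l)) *
  sin (phi - p / al * th + sin th * exp (al * y + l))).

(* The derivative of [ray] in [th] and of [ray_primitive] in [y]. *)
Definition ray_derivative (al l p phi th y : R) : R :=
  exp (p * y - cos th * exp (al * y + l)) *
  ((p / al - cos th * exp (al * y + l)) * sin (phi - p / al * th + sin th * exp (al * y + l))
   + sin th * exp (al * y + l) * cos (phi - p / al * th + sin th * exp (al * y + l))).

Section Ray.
Variables al l p phi : R.
Hypothesis al0 : 0 < al.
Hypothesis p0 : 0 < p.

Lemma is_derive_ray (th y : R) :
  is_derive (fun u => ray al l p phi u y) th (ray_derivative al l p phi th y).
Proof. unfold ray, ray_derivative; auto_derive; auto; unfold Rminus, Rdiv; ring. Qed.

Lemma is_derive_ray_primitive (th y : R) :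
  is_derive (ray_primitive al l p phi th) y (ray_derivative al l p phi th y).
Proof. unfold ray_primitive, ray_derivative; auto_derive; auto; unfold Rminus; field; lra. Qed.

Lemma continuous_ray (th y : R) : continuous (ray al l p phi th) y.
Proof. apply continuous_of_derive; intros z; unfold ray; auto_derive; auto. Qed.

Lemma continuous_ray_derivative (th y : R) : continuous (ray_derivative al l p phi th) y.
Proof. apply continuous_of_derive; intros z; unfold ray_derivative; auto_derive; auto. Qed.

Lemma continuity_2d_ray_derivative (th y : R) : continuity_2d_pt (ray_derivative al l p phi) th y.
Proof.
assert (ce : forall x, continuity_pt exp x) by (intros x; apply derivable_continuous_pt, derivable_pt_exp).
assert (cc : forall x, continuity_pt cos x) by (intros x; apply continuity_cos).
assert (cs : forall x, continuity_pt sin x) by (intros x; apply continuity_sin).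
unfold ray_derivative.
repeat first
 [ apply continuity_2d_pt_const | apply continuity_2d_pt_id1 | apply continuity_2d_pt_id2
 | apply continuity_2d_pt_plus | apply continuity_2d_pt_opp | apply continuity_2d_pt_mult
 | apply (continuity_1d_2d_pt_comp exp); [apply ce|]
 | apply (continuity_1d_2d_pt_comp cos); [apply cc|]
 | apply (continuity_1d_2d_pt_comp sin); [apply cs|] ].
Qed.

Lemma is_derive_RInt_ray (a b th : R) :
  is_derive (fun u => RInt (ray al l p phi u) a b) th
    (ray_primitive al l p phi th b - ray_primitive al l p phi th a).
Proof.
assert (D : forall u y, Derive (fun z => ray al l p phi z y) u = ray_derivative al l p phi u y)
  by (intros; apply is_derive_unique, is_derive_ray).
replace (ray_primitive al l p phi th b - ray_primitive al l p phi th a)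
  with (RInt (fun y => Derive (fun u => ray al l p phi u y) th) a b).
- apply (is_derive_RInt_param (fun u y => ray al l p phi u y)).
  + apply filter_forall; intros u y _; eexists; apply is_derive_ray.
  + intros y _; apply continuity_2d_pt_ext with (ray_derivative al l p phi); [now intros; rewrite D|].
    apply continuity_2d_ray_derivative.
  + apply filter_forall; intros u; apply ex_RInt_continuous_all; apply continuous_ray.
- rewrite (RInt_ext (V := R_CompleteNormedModule) _ (ray_derivative al l p phi th)) by (intros; apply D).
  apply (is_RInt_unique (V := R_CompleteNormedModule)).
  apply (is_RInt_derive (V := R_CompleteNormedModule)).
  + intros y _; apply is_derive_ray_primitive.
  + intros y _; apply continuous_ray_derivative.
Qed.

(** The mean value theorem in the angle leaves end values at an intermediate angle [c]; as cosine
    decreases, [cos th <= cos c], so the envelope at [th] bounds them all. *)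
Lemma RInt_ray_dist (a b th : R) : 0 <= th < PI / 2 ->
  Rabs (RInt (ray al l p phi th) a b - RInt (ray al l p phi 0) a b) <=
  th / al * (exp (p * a - cos th * exp (al * a + l)) + exp (p * b - cos th * exp (al * b + l))).
Proof.
intros hth; assert (P := PI_RGT_0).
destruct (MVT_gen (fun u => RInt (ray al l p phi u) a b) 0 th
  (fun u => ray_primitive al l p phi u b - ray_primitive al l p phi u a)) as [c [hc ->]].
- intros u _; apply is_derive_RInt_ray.
- intros u _; apply continuity_pt_filterlim.
  apply (continuous_of_derive (fun u => RInt (ray al l p phi u) a b)).
  intros v; eexists; apply is_derive_RInt_ray.
- rewrite Rmin_left, Rmax_right in hc by lra.
  assert (B : forall y, Rabs (ray_primitive al l p phi c y) <= / al * exp (p * y - cos th * exp (al * y + l))).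
  { intros y; unfold ray_primitive; assert (i0 : 0 < / al) by now apply Rinv_0_lt_compat.
    rewrite Rabs_mult, (Rabs_pos_eq (/ al)) by lra; apply Rmult_le_compat_l; [lra|].
    rewrite Rabs_mult, (Rabs_pos_eq (exp _)) by apply Rlt_le, exp_pos.
    rewrite <- (Rmult_1_r (exp (p * y - cos th * exp (al * y + l)))).
    apply Rmult_le_compat; [apply Rlt_le, exp_pos | apply Rabs_pos | | apply Rabs_le, SIN_bound].
    apply exp_le.
    assert (cos th <= cos c) by (apply cos_decr_1; lra).
    generalize (exp_pos (al * y + l)); nra. }
  rewrite Rminus_0_r, Rabs_mult, (Rabs_pos_eq th) by lra.
  generalize (B a) (B b); intros h1 h2.
  assert (h3 := Rabs_triang (ray_primitive al l p phi c b) (- ray_primitive al l p phi c a)).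
  rewrite Rabs_Ropp in h3; unfold Rminus at 1.
  unfold Rdiv; rewrite Rmult_comm, Rmult_assoc; apply Rmult_le_compat_l; lra.
Qed.

Lemma is_lim_ray_envelope (th : R) (z : Rbar) : 0 <= th < PI / 2 -> z = m_infty \/ z = p_infty ->
  is_lim (fun y => exp (p * y - cos th * exp (al * y + l))) z 0.
Proof.
intros hth hz; assert (0 < cos th) by (apply cos_gt_0; lra).
apply is_lim_ext with (fun y => exp (p * y - (cos th * exp l) * exp (al * y))).
- intros y; rewrite exp_plus; f_equal; ring.
- apply is_lim_exp_exp; try easy; apply Rmult_lt_0_compat; [easy | apply exp_pos].
Qed.

(* Cauchy's theorem on a sector: the integral along a ray does not depend on its angle. *)
Lemma is_RInt_line_ray_rotate (th L : R) : 0 <= th < PI / 2 ->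
  is_RInt_line (ray al l p phi 0) L -> is_RInt_line (ray al l p phi th) L.
Proof.
intros hth H.
apply is_RInt_line_filterlim in H; [|apply continuous_ray].
apply is_RInt_line_filterlim; [apply continuous_ray|].
apply filterlim_locally; intros eps.
assert (e2 : 0 < eps / 2) by (generalize (cond_pos eps); lra).
assert (H2 := proj1 (filterlim_locally _ L) H (mkposreal _ e2)).
(* The added 1 keeps [K] positive when [th = 0]. Envelopes below eps / (4 K) at both ends cost eps /
   2 in total. *)
pose (K := th / al + 1).
assert (K0 : 0 <= th / al) by (apply Rmult_le_pos; [lra | apply Rlt_le, Rinv_0_lt_compat; lra]).
assert (K1 : 0 < K) by (unfold K; lra).
assert (e3 : 0 < eps / (4 * K)) by (apply Rdiv_lt_0_compat; [apply cond_pos|lra]).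
pose (B := fun y => exp (p * y - cos th * exp (al * y + l))).
assert (HB : filter_prod (Rbar_locally m_infty) (Rbar_locally p_infty)
  (fun ab => Rabs (B (fst ab)) < eps / (4 * K) /\ Rabs (B (snd ab)) < eps / (4 * K))).
{ apply Filter_prod with (fun a => Rabs (B a) < eps / (4 * K)) (fun a => Rabs (B a) < eps / (4 * K)).
  - apply (is_lim_ray_envelope th m_infty hth (or_introl eq_refl)
      (fun y => Rabs y < eps / (4 * K))).
    exists (mkposreal _ e3); intros y hy; change (Rabs (y - 0) < eps / (4 * K)) in hy.
    now rewrite Rminus_0_r in hy.
  - apply (is_lim_ray_envelope th p_infty hth (or_intror eq_refl)
      (fun y => Rabs y < eps / (4 * K))).
    exists (mkposreal _ e3); intros y hy; change (Rabs (y - 0) < eps / (4 * K)) in hy.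
    now rewrite Rminus_0_r in hy.
  - now intros. }
generalize (filter_and _ _ H2 HB); apply filter_imp.
intros [a b]; simpl; intros [h1 [h2 h3]].
change (Rabs (RInt (ray al l p phi 0) a b - L) < eps / 2) in h1.
change (Rabs (RInt (ray al l p phi th) a b - L) < eps).
assert (h4 := RInt_ray_dist a b th hth).
apply Rabs_def2 in h2; apply Rabs_def2 in h3.
change (Rabs (RInt (ray al l p phi th) a b - RInt (ray al l p phi 0) a b) <= th / al * (B a + B b)) in h4.
assert (h5 : th / al * (B a + B b) <= K * (eps / (4 * K) + eps / (4 * K))).
{ assert (0 < B a) by apply exp_pos; assert (0 < B b) by apply exp_pos.
  apply Rmult_le_compat; unfold K in *; lra. }
replace (K * (eps / (4 * K) + eps / (4 * K))) with (eps / 2) in h5 by (field; lra).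
replace (RInt (ray al l p phi th) a b - L)
  with ((RInt (ray al l p phi th) a b - RInt (ray al l p phi 0) a b) + (RInt (ray al l p phi 0) a b - L)) by ring.
apply Rle_lt_trans with (1 := Rabs_triang _ _); lra.
Qed.

Lemma is_RInt_line_ray (th : R) : 0 <= th < PI / 2 ->
  is_RInt_line (ray al l p phi th) (/ al * exp (- (p / al) * l) * Gam (p / al) * cos phi).
Proof.
intros hth; apply is_RInt_line_ray_rotate; [easy|].
assert (pa : 0 < p / al) by now apply Rdiv_lt_0_compat.
(* At angle 0 the substitution [al * y + l] turns Euler's integral at [p / al] into the ray
   integral. The phase [- p / al * th] built into [ray] keeps the value independent of the angle. *)
assert (H := is_RInt_line_comp_lin _ al l _ al0 (Gam_correct _ pa)).
apply (is_RInt_gen_scal (V := R_NormedModule) _ (/ al * exp (- (p / al) * l) * cos phi)) in H.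
replace (/ al * exp (- (p / al) * l) * Gam (p / al) * cos phi)
  with (scal (/ al * exp (- (p / al) * l) * cos phi) (Gam (p / al)))
  by (unfold scal; simpl; unfold mult; simpl; ring).
apply is_RInt_line_ext with (2 := H); intros y.
unfold scal; simpl; unfold mult; simpl; unfold ray, gamma_kernel.
rewrite cos_0, sin_0.
replace (phi - p / al * 0 + 0 * exp (al * y + l)) with phi by ring.
replace (p * y - 1 * exp (al * y + l))
  with (- (p / al) * l + (p / al * (al * y + l) - exp (al * y + l))) by (field; lra).
rewrite (exp_plus (- (p / al) * l)); field; lra.
Qed.
End Ray.

(** * Taylor expansion of the cosine and uniform approximation *)

Fixpoint psum (a : nat -> R) (N : nat) : R :=
  match N with
  | O => 0
  | S n => psum a n + a n
  end.

(** [sum_n] includes its last index and [psum] stops before it. The empty sum at 0 lets the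
    remainder estimate start from |cos| <= 1. *)
Lemma sum_n_psum (a : nat -> R) (n : nat) : sum_n a n = psum a (S n).
Proof.
induction n as [|n IH]; [rewrite sum_O; simpl; ring|].
rewrite sum_Sn, IH; reflexivity.
Qed.

(** Each differentiation of cos (A - z) in z lowers the phase by PI / 2, so this is its k-th Taylor
    term at 0. *)
Definition cos_jet (A z : R) (k : nat) : R :=
  z ^ k / INR (fact k) * cos (A - INR k * (PI / 2)).

Lemma is_derive_psum_cos_jet (A z : R) (N : nat) :
  is_derive (fun z => psum (cos_jet A z) (S N)) z (psum (cos_jet (A - PI / 2) z) N).
Proof.
induction N as [|N IH].
- simpl; unfold cos_jet; apply is_derive_ext with (fun _ => cos A).
  + intros t; simpl; rewrite Rmult_0_l, Rminus_0_r; field.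
  + apply (is_derive_const (K := R_AbsRing) (V := R_NormedModule)).
- apply (is_derive_plus (K := R_AbsRing) (V := R_NormedModule)
    (fun z => psum (cos_jet A z) (S N)) (fun z => cos_jet A z (S N))); [exact IH|].
  unfold cos_jet; auto_derive; auto.
  change (match N with O => 1 | S _ => INR N + 1 end) with (INR (S N)).
  change (fact N + N * fact N)%nat with (fact (S N)).
  replace (A - PI / 2 - INR N * (PI / 2)) with (A - INR (S N) * (PI / 2)) by (rewrite S_INR; ring).
  rewrite fact_simpl, mult_INR.
  assert (F := INR_fact_neq_0 N); assert (INR (S N) <> 0) by (apply not_0_INR; lia).
  field; auto.
Qed.

Lemma psum_cos_jet_0 (A : R) (N : nat) : psum (cos_jet A 0) (S N) = cos A.
Proof.
induction N as [|N IH].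
- unfold cos_jet; simpl; rewrite Rmult_0_l, Rminus_0_r; field.
- change (psum (cos_jet A 0) (S N) + cos_jet A 0 (S N) = cos A); rewrite IH.
  unfold cos_jet; simpl; unfold Rdiv; ring.
Qed.

Lemma nonneg_of_derive (f df : R -> R) (z : R) : 0 <= z -> f 0 = 0 ->
  (forall t, is_derive f t (df t)) -> (forall t, 0 <= t -> 0 <= df t) -> 0 <= f z.
Proof.
intros z0 f0 D pos.
destruct (MVT_gen f 0 z df) as [c [hc e]].
- intros; apply D.
- intros u _; apply continuity_pt_filterlim.
  apply (continuous_of_derive f); intros v; eexists; apply D.
- rewrite Rmin_left, Rmax_right in hc by lra.
  assert (0 <= df c * (z - 0)) by (apply Rmult_le_pos; [apply pos|]; lra).
  lra.
Qed.

Lemma is_derive_pow_fact (N : nat) (z : R) :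
  is_derive (fun z => z ^ S N / INR (fact (S N))) z (z ^ N / INR (fact N)).
Proof.
auto_derive; auto.
change (match N with O => 1 | S _ => INR N + 1 end) with (INR (S N)).
change (fact N + N * fact N)%nat with (fact (S N)).
change (Init.Nat.pred (S N)) with N.
rewrite fact_simpl, mult_INR.
assert (F := INR_fact_neq_0 N); assert (INR (S N) <> 0) by (apply not_0_INR; lia).
field; auto.
Qed.

(** Differentiation turns the remainder of order N + 1 with phase A into the one of order N with
    phase A - PI / 2. Adding it to, or subtracting it from, the bound gives functions that vanish at
    0 and have nonnegative derivative by induction. *)
Lemma cos_jet_remainder (N : nat) (A z : R) : 0 <= z ->
  Rabs (cos (A - z) - psum (cos_jet A z) N) <= z ^ N / INR (fact N).
Proof.
revert A z; induction N as [|N IH]; intros A z z0.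
- simpl; rewrite Rminus_0_r; replace (1 / 1) with 1 by field; apply Rabs_le, COS_bound.
- assert (Z0 : 0 ^ S N / INR (fact (S N)) = 0) by (simpl; unfold Rdiv; ring).
  assert (D : forall t, is_derive (fun z => cos (A - z) - psum (cos_jet A z) (S N)) t
    (cos (A - PI / 2 - t) - psum (cos_jet (A - PI / 2) t) N)).
  { intros t; apply (is_derive_minus (K := R_AbsRing) (V := R_NormedModule)); [|apply is_derive_psum_cos_jet].
    auto_derive; auto.
    replace (A - PI / 2 - t) with (- (PI / 2 - (A - t))) by ring.
    rewrite cos_neg, cos_shift; unfold Rminus; ring. }
  apply Rabs_le; split.
  + cut (0 <= z ^ S N / INR (fact (S N)) + (cos (A - z) - psum (cos_jet A z) (S N))); [lra|].
    apply (nonneg_of_derive (fun z => z ^ S N / INR (fact (S N)) + (cos (A - z) - psum (cos_jet A z) (S N)))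
      (fun t => t ^ N / INR (fact N) + (cos (A - PI / 2 - t) - psum (cos_jet (A - PI / 2) t) N))); [easy| | |].
    * rewrite psum_cos_jet_0, Z0, Rminus_0_r; ring.
    * intros t; apply (is_derive_plus (K := R_AbsRing) (V := R_NormedModule)); [apply is_derive_pow_fact | apply D].
    * intros t t0; generalize (proj1 (Rabs_le_between _ _) (IH (A - PI / 2) t t0)); lra.
  + cut (0 <= z ^ S N / INR (fact (S N)) - (cos (A - z) - psum (cos_jet A z) (S N))); [lra|].
    apply (nonneg_of_derive (fun z => z ^ S N / INR (fact (S N)) - (cos (A - z) - psum (cos_jet A z) (S N)))
      (fun t => t ^ N / INR (fact N) - (cos (A - PI / 2 - t) - psum (cos_jet (A - PI / 2) t) N))); [easy| | |].
    * rewrite psum_cos_jet_0, Z0, Rminus_0_r; ring.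
    * intros t; apply (is_derive_minus (K := R_AbsRing) (V := R_NormedModule)); [apply is_derive_pow_fact | apply D].
    * intros t t0; generalize (proj1 (Rabs_le_between _ _) (IH (A - PI / 2) t t0)); lra.
Qed.

Lemma pow_fact_le_exp (N : nat) (z : R) : 0 <= z -> z ^ N / INR (fact N) <= exp z.
Proof.
revert z; induction N as [|N IH]; intros z z0.
- simpl; replace (1 / 1) with 1 by field; generalize (exp_ineq1_le z); lra.
(* Subtracting 1 makes the difference vanish at 0. *)
- cut (0 <= (exp z - 1) - z ^ S N / INR (fact (S N))); [lra|].
  apply (nonneg_of_derive (fun z => (exp z - 1) - z ^ S N / INR (fact (S N)))
     (fun t => exp t - t ^ N / INR (fact N))); [easy| | |].
  + rewrite exp_0; simpl; unfold Rdiv; ring.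
  + intros t; apply (is_derive_minus (K := R_AbsRing) (V := R_NormedModule)); [|apply is_derive_pow_fact].
    auto_derive; auto; ring.
  + intros t t0; generalize (IH t t0); lra.
Qed.

Lemma filterlim_psum {T : Type} (F : (T -> Prop) -> Prop) {FF : Filter F}
  (J : nat -> T -> R) (a : nat -> R) (N : nat) :
  (forall k, filterlim (J k) F (locally (a k))) ->
  filterlim (fun x => psum (fun k => J k x) N) F (locally (psum a N)).
Proof.
intros H; induction N as [|N IH]; simpl.
- apply filterlim_const.
- apply (filterlim_comp_2 (G := locally (psum a N)) (H := locally (a N)) _ _ Rplus IH (H N)).
  apply (filterlim_plus (V := R_NormedModule)).
Qed.

(** Exchange of limits: since [e] does not depend on [x], [I] is Cauchy along [F], and passing to
    the limit in the uniform bound leaves the partial sums within [e N] of the limit of [I].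
    Summability of [a] is thus a conclusion. *)
Lemma is_series_of_uniform_approx {T : Type} (F : (T -> Prop) -> Prop) {FF : ProperFilter F}
  (I : T -> R) (J : nat -> T -> R) (a : nat -> R) (e : nat -> R) :
  (forall k, filterlim (J k) F (locally (a k))) ->
  (forall N x, Rabs (I x - psum (fun k => J k x) N) <= e N) ->
  is_lim_seq e 0 ->
  exists L : R, is_series a L /\ filterlim I F (locally L).
Proof.
intros HJ He e0.
assert (near : forall (eps : posreal) N, F (fun x => Rabs (I x - psum a N) < e N + eps)).
{ intros eps N.
  generalize (proj1 (filterlim_locally _ _) (filterlim_psum F J a N HJ) eps); apply filter_imp.
  intros x hx; change (Rabs (psum (fun k => J k x) N - psum a N) < eps) in hx.
  specialize (He N x).
  replace (I x - psum a N) with ((I x - psum (fun k => J k x) N) + (psum (fun k => J k x) N - psum a N)) by ring.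
  apply Rle_lt_trans with (1 := Rabs_triang _ _); lra. }
assert (small : forall eps : posreal, exists N0, forall N, (N0 <= N)%nat -> e N < eps).
{ intros eps; destruct (e0 (fun y => y < eps)) as [N0 HN0].
  - exists eps; intros y hy; change (Rabs (y - 0) < eps) in hy; apply Rabs_def2 in hy; lra.
  - now exists N0. }
assert (C : exists L : R_CompleteSpace, filterlim I F (locally L)).
{ apply filterlim_locally_cauchy; intros eps.
  assert (e4 : 0 < eps / 4) by (generalize (cond_pos eps); lra).
  destruct (small (mkposreal _ e4)) as [N HN]; specialize (HN N (le_n _)); simpl in HN.
  exists (fun x => Rabs (I x - psum a N) < e N + eps / 4); split.
  - apply (near (mkposreal _ e4)).
  - intros u v hu hv; change (Rabs (I v - I u) < eps).
    apply Rabs_def2 in hu; apply Rabs_def2 in hv; apply Rabs_def1; lra. }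
destruct C as [L HL]; exists L; split; [|exact HL].
assert (dist : forall N, Rabs (L - psum a N) <= e N).
{ intros N; apply le_epsilon; intros eps eps0.
  assert (e2 : 0 < eps / 2) by lra.
  destruct (filter_ex _ (filter_and _ _ (near (mkposreal _ e2) N)
    (proj1 (filterlim_locally _ L) HL (mkposreal _ e2)))) as [x [h1 h2]].
  simpl in h1; change (Rabs (I x - L) < eps / 2) in h2.
  apply Rabs_def2 in h1; apply Rabs_def2 in h2; apply Rabs_le; lra. }
unfold is_series.
apply (is_lim_seq_ext (fun n => psum a (S n)) (sum_n a) L).
{ intros n; symmetry; apply sum_n_psum. }
apply (is_lim_seq_incr_1 (psum a)).
apply is_lim_seq_le_le with (fun n => L - e n) (fun n => L + e n).
- intros n; generalize (proj1 (Rabs_le_between _ _) (dist n)); lra.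
- replace (Finite L) with (Finite (L - 0)) by (f_equal; ring).
  apply is_lim_seq_minus'; [apply is_lim_seq_const | exact e0].
- replace (Finite L) with (Finite (L + 0)) by (f_equal; ring).
  apply is_lim_seq_plus'; [apply is_lim_seq_const | exact e0].
Qed.

(** * Termwise integration *)

(** [y0] is the crossover where [c * exp (al * y)] equals [K * exp y]; the first dominates to its
    right because [al > 1], and the constant suffices to its left. *)
Lemma exp_exp_dominates_exp (c al K : R) :
  0 < c -> 1 < al -> 0 < K -> exists M, forall y, K * exp y <= c * exp (al * y) + M.
Proof.
intros c0 al1 K0.
pose (y0 := ln (K / c) / (al - 1)).
exists (K * exp y0); intros y.
destruct (Rle_dec y y0) as [h|h].
- assert (exp y <= exp y0) by now apply exp_le.
  assert (0 < c * exp (al * y)) by (apply Rmult_lt_0_compat; [easy | apply exp_pos]).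
  nra.
- assert (0 < K * exp y0) by (apply Rmult_lt_0_compat; [easy | apply exp_pos]).
  replace (al * y) with ((al - 1) * y + y) by ring; rewrite exp_plus.
  assert (e : exp ((al - 1) * y0) = K / c).
  { unfold y0; replace ((al - 1) * (ln (K / c) / (al - 1))) with (ln (K / c)) by (field; lra).
    apply exp_ln; now apply Rdiv_lt_0_compat. }
  assert (h2 : K / c <= exp ((al - 1) * y)) by (rewrite <- e; apply exp_le; nra).
  assert (h3 : c * (K / c) <= c * exp ((al - 1) * y)) by (apply Rmult_le_compat_l; lra).
  replace (c * (K / c)) with K in h3 by (field; lra).
  generalize (exp_pos y); nra.
Qed.

(** The substitution is [b = exp y] with [eta = exp l]; the leading [y] in the exponent is the
    Jacobian. Phase 0 yields the real part of the stable integrand, phase - PI / 2 the imaginary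
    part. *)
Definition half_integrand (X al l th phi y : R) : R :=
  exp (y - cos th * exp (al * y + l)) * cos (phi + sin th * exp (al * y + l) - X * exp y).

Definition series_term (X al l th phi : R) (k : nat) : R :=
  X ^ k / INR (fact k) *
  (/ al * exp (- ((INR k + 1) / al) * l) * Gam ((INR k + 1) / al) *
   cos ((INR k + 1) / al * th + phi - INR k * (PI / 2))).

Lemma is_RInt_psum (f : nat -> R -> R) (a b : R) (N : nat) :
  (forall k, ex_RInt (f k) a b) ->
  is_RInt (fun y => psum (fun k => f k y) N) a b (psum (fun k => RInt (f k) a b) N).
Proof.
intros H; induction N as [|N IH]; simpl.
- generalize (is_RInt_const (V := R_NormedModule) a b 0).
  unfold scal; simpl; unfold mult; simpl; now rewrite Rmult_0_r.
- apply (is_RInt_plus (V := R_NormedModule)); [exact IH|].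
  now apply (RInt_correct (V := R_CompleteNormedModule)).
Qed.

Lemma psum_ext (a b : nat -> R) (N : nat) : (forall k, a k = b k) -> psum a N = psum b N.
Proof. intros H; induction N as [|N IH]; simpl; [easy | now rewrite IH, H]. Qed.

Lemma psum_scal (c : R) (a : nat -> R) (N : nat) : psum (fun k => c * a k) N = c * psum a N.
Proof. induction N as [|N IH]; simpl; [ring | rewrite IH; ring]. Qed.

Lemma exp_INR_mul (n : nat) (y : R) : exp (INR n * y) = exp y ^ n.
Proof.
induction n as [|n IH]; [simpl; now rewrite Rmult_0_l, exp_0|].
rewrite S_INR, Rmult_plus_distr_r, exp_plus, IH, Rmult_1_l; simpl; ring.
Qed.

(** The cosine is expanded in powers of [X * exp y]. Each term is a ray integral with [p = k + 1],
    and the remainder is bounded independently of the truncation. *)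
Lemma half_integrand_series (X al l th phi : R) : 0 <= X -> 1 < al -> 0 <= th < PI / 2 ->
  exists L : R, is_series (series_term X al l th phi) L /\
    is_RInt_line (half_integrand X al l th phi) L.
Proof.
intros X0 al1 hth.
assert (cH : forall y, continuous (half_integrand X al l th phi) y).
{ apply continuous_of_derive; intros y; unfold half_integrand; auto_derive; auto. }
(* The part [(INR k + 1) / al * th] cancels the rotation phase inside [ray], leaving the Taylor
   phase phi - k PI / 2. *)
pose (ph := fun k => (INR k + 1) / al * th + phi - INR k * (PI / 2)).
pose (T := fun k y => X ^ k / INR (fact k) * ray al l (INR k + 1) (ph k) th y).
assert (cT : forall k y, continuous (T k) y).
{ intros k; apply continuous_of_derive; intros y; unfold T, ray; auto_derive; auto. }
assert (hT : forall k, is_RInt_line (T k) (series_term X al l th phi k)).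
{ intros k; apply (is_RInt_gen_scal (V := R_NormedModule)).
  apply is_RInt_line_ray; try lra; generalize (pos_INR k); lra. }
assert (c0 : 0 < cos th) by (apply cos_gt_0; lra).
(* [2 * X] absorbs the factor [exp (2 * z)] of the remainder bound; the extra 1 leaves
   [exp (- exp y)], whose product with [exp y] has a bounded antiderivative. *)
destruct (exp_exp_dominates_exp (cos th * exp l) al (2 * X + 1)) as [M HM]; try lra.
{ apply Rmult_lt_0_compat; [easy | apply exp_pos]. }
assert (sumT : forall N y, psum (fun k => T k y) N =
  exp (y - cos th * exp (al * y + l)) * psum (cos_jet (phi + sin th * exp (al * y + l)) (X * exp y)) N).
{ intros N y; rewrite <- psum_scal; apply psum_ext; intros k.
  unfold T, cos_jet, ray, ph.
  replace ((INR k + 1) / al * th + phi - INR k * (PI / 2) - (INR k + 1) / al * th + sin th * exp (al * y + l))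
    with (phi + sin th * exp (al * y + l) - INR k * (PI / 2)) by ring.
  replace ((INR k + 1) * y - cos th * exp (al * y + l))
    with (INR k * y + (y - cos th * exp (al * y + l))) by ring.
  rewrite exp_plus, exp_INR_mul, Rpow_mult_distr; unfold Rdiv; ring. }
pose (Phi := fun (N : nat) y => - ((1 / 2) ^ N * exp M) * exp (- exp y)).
assert (bound : forall N y, Rabs (half_integrand X al l th phi y - psum (fun k => T k y) N) <=
  (1 / 2) ^ N * exp M * (exp y * exp (- exp y))).
{ intros N y; rewrite sumT; unfold half_integrand; rewrite <- Rmult_minus_distr_l, Rabs_mult.
  rewrite Rabs_pos_eq by apply Rlt_le, exp_pos.
  set (z := X * exp y); assert (z0 : 0 <= z) by (apply Rmult_le_pos; [easy | apply Rlt_le, exp_pos]).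
  assert (h1 := cos_jet_remainder N (phi + sin th * exp (al * y + l)) z z0).
  assert (h2 := pow_fact_le_exp N (2 * z) ltac:(lra)).
  (* Doubling [z] buys the geometric factor that makes the error tend to 0 uniformly in [y]. *)
  assert (h3 : z ^ N / INR (fact N) = (1 / 2) ^ N * ((2 * z) ^ N / INR (fact N))).
  { unfold Rdiv at 1 3; rewrite <- Rmult_assoc, <- Rpow_mult_distr; do 2 f_equal; field. }
  assert (p0 : 0 < (1 / 2) ^ N) by (apply pow_lt; lra).
  assert (h4 : z ^ N / INR (fact N) <= (1 / 2) ^ N * exp (2 * z))
    by (rewrite h3; apply Rmult_le_compat_l; lra).
  apply Rle_trans with (exp (y - cos th * exp (al * y + l)) * ((1 / 2) ^ N * exp (2 * z))).
  { apply Rmult_le_compat_l; [apply Rlt_le, exp_pos | lra]. }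
  rewrite <- Rmult_assoc, (Rmult_comm _ ((1 / 2) ^ N)), !Rmult_assoc.
  apply Rmult_le_compat_l; [lra|].
  rewrite <- !exp_plus; apply exp_le.
  generalize (HM y); rewrite exp_plus; unfold z; lra. }
assert (HF : forall k, filterlim (fun ab : R * R => RInt (T k) (fst ab) (snd ab))
  (filter_prod (Rbar_locally m_infty) (Rbar_locally p_infty)) (locally (series_term X al l th phi k))).
{ intros k; apply is_RInt_line_filterlim; [apply cT | apply hT]. }
destruct (is_series_of_uniform_approx (filter_prod (Rbar_locally m_infty) (Rbar_locally p_infty))
  (fun ab => RInt (half_integrand X al l th phi) (fst ab) (snd ab))
  (fun k ab => RInt (T k) (fst ab) (snd ab)) (series_term X al l th phi)
  (fun N => exp M * (1 / 2) ^ N) HF) as [L [HL1 HL2]].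
- intros N [a b]; simpl.
  assert (exT : forall k, ex_RInt (T k) a b) by (intros k; apply ex_RInt_continuous_all, cT).
  assert (cS : forall y, continuous (fun y => psum (fun k => T k y) N) y).
  { clear - cT; intros y; induction N as [|N IH]; simpl.
    - apply continuous_const.
    - apply (continuous_plus (V := R_NormedModule)); [exact IH | apply cT]. }
  rewrite <- (is_RInt_unique (V := R_CompleteNormedModule) _ _ _ _ (is_RInt_psum T a b N exT)).
  change (Rabs (minus (RInt (half_integrand X al l th phi) a b) (RInt (fun y => psum (fun k => T k y) N) a b))
    <= exp M * (1 / 2) ^ N).
  rewrite <- (RInt_minus (V := R_CompleteNormedModule)) by now apply ex_RInt_continuous_all.
  apply Rle_trans with (Rabs (Phi N b - Phi N a)).
  + apply abs_RInt_le_antiderivative with (fun y => (1 / 2) ^ N * exp M * (exp y * exp (- exp y))).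
    * intros y; apply (continuous_minus (V := R_NormedModule)); [apply cH | apply cS].
    * intros y; unfold Phi; auto_derive; auto; ring.
    * apply continuous_of_derive; intros y; auto_derive; auto.
    * intros y; apply bound.
  + unfold Phi.
    assert (p0 : 0 < (1 / 2) ^ N) by (apply pow_lt; lra).
    replace (- ((1 / 2) ^ N * exp M) * exp (- exp b) - - ((1 / 2) ^ N * exp M) * exp (- exp a))
      with (exp M * (1 / 2) ^ N * (exp (- exp a) - exp (- exp b))) by ring.
    rewrite Rabs_mult, Rabs_pos_eq by (apply Rlt_le, Rmult_lt_0_compat; [apply exp_pos | easy]).
    rewrite <- (Rmult_1_r (exp M * (1 / 2) ^ N)) at 2.
    apply Rmult_le_compat_l; [apply Rlt_le, Rmult_lt_0_compat; [apply exp_pos | easy]|].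
    assert (B : forall u, 0 < exp (- exp u) < 1).
    { intros u; split; [apply exp_pos|]; rewrite <- exp_0; apply exp_increasing.
      generalize (exp_pos u); lra. }
    apply Rabs_le; generalize (B a) (B b); lra.
- replace (Finite 0) with (Finite (exp M * 0)) by (f_equal; ring).
  apply is_lim_seq_mult'; [apply is_lim_seq_const|].
  apply is_lim_seq_geom; rewrite Rabs_pos_eq; lra.
- exists L; split; [exact HL1|].
  now apply is_RInt_line_filterlim.
Qed.

(** * From the logarithmic variable back to the half-line *)

Definition half_density (X al eta th phi b : R) : R :=
  exp (- (cos th * (eta * abspow b al))) * cos (phi + sin th * (eta * abspow b al) - X * b).

Lemma abspow_exp (y al : R) : abspow (exp y) al = exp (al * y).
Proof.
assert (e := exp_pos y); unfold abspow.
destruct (Req_EM_T (exp y) 0) as [h|_]; [lra|].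
rewrite Rabs_pos_eq by lra; unfold Rpower; now rewrite ln_exp.
Qed.

Lemma abspow_continuous (al b : R) : 1 < al -> continuous (fun b => abspow b al) b.
Proof.
intros al1; destruct (Req_dec b 0) as [->|b0].
- apply filterlim_locally; intros eps.
  assert (m0 : 0 < Rmin eps 1) by (apply Rmin_pos; [apply cond_pos | lra]).
  exists (mkposreal _ m0); intros y hy.
  change (Rabs (y - 0) < Rmin eps 1) in hy; rewrite Rminus_0_r in hy.
  change (Rabs (abspow y al - abspow 0 al) < eps).
  unfold abspow at 2; destruct (Req_EM_T 0 0) as [_|]; [|easy].
  rewrite Rminus_0_r; unfold abspow; destruct (Req_EM_T y 0) as [_|y0].
  + rewrite Rabs_R0; apply cond_pos.
  + rewrite Rabs_pos_eq by apply Rlt_le, exp_pos.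
    (* For |y| < 1 an exponent above 1 gives |y|^al <= |y|. *)
    apply Rle_lt_trans with (Rabs y).
    * assert (a0 := Rabs_pos_lt y y0).
      rewrite <- (exp_ln (Rabs y)) at 2 by easy; apply exp_le.
      assert (ln (Rabs y) <= 0).
      { rewrite <- ln_1; apply Rlt_le, ln_increasing; [easy|].
        apply Rlt_le_trans with (1 := hy), Rmin_r. }
      nra.
    * apply Rlt_le_trans with (1 := hy), Rmin_l.
- apply continuous_ext_loc with (fun b => exp (al * ln (Rabs b))).
  + assert (a0 := Rabs_pos_lt b b0).
    exists (mkposreal _ a0); intros y hy; change (Rabs (y - b) < Rabs b) in hy.
    unfold abspow; destruct (Req_EM_T y 0) as [->|_]; [|easy].
    rewrite Rminus_0_l, Rabs_Ropp in hy; lra.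
  + assert (a0 := Rabs_pos_lt b b0).
    apply (ex_derive_continuous (V := R_NormedModule)); auto_derive; auto.
Qed.

Lemma half_density_continuous (X al eta th phi b : R) :
  1 < al -> continuous (half_density X al eta th phi) b.
Proof.
intros al1; assert (c := abspow_continuous al b al1).
assert (cx : forall k, continuous (fun b => k * (eta * abspow b al)) b).
{ intros k; apply (continuous_scal_r (V := R_NormedModule) k).
  now apply (continuous_scal_r (V := R_NormedModule) eta). }
apply (continuous_mult (K := R_AbsRing)).
- apply (continuous_comp (fun b => - (cos th * (eta * abspow b al))) exp).
  + now apply (continuous_opp (V := R_NormedModule)).
  + apply continuous_exp.
- apply (continuous_comp (fun b => phi + sin th * (eta * abspow b al) - X * b) cos).
  + apply (continuous_minus (V := R_NormedModule)).
    * apply (continuous_plus (V := R_NormedModule)); [apply continuous_const | apply cx].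
    * apply (continuous_scal_r (V := R_NormedModule) X), continuous_id.
  + apply continuous_cos.
Qed.

Lemma half_density_bound (X al eta th phi b : R) :
  0 < eta -> 0 <= cos th -> Rabs (half_density X al eta th phi b) <= 1.
Proof.
intros e0 c0; unfold half_density.
rewrite Rabs_mult, (Rabs_pos_eq (exp _)) by apply Rlt_le, exp_pos.
rewrite <- (Rmult_1_r 1).
apply Rmult_le_compat; [apply Rlt_le, exp_pos | apply Rabs_pos | | apply Rabs_le, COS_bound].
rewrite <- exp_0; apply exp_le.
assert (0 <= abspow b al).
{ unfold abspow; destruct (Req_EM_T b 0); [lra | apply Rlt_le, exp_pos]. }
assert (0 <= cos th * (eta * abspow b al)) by (repeat apply Rmult_le_pos; lra).
lra.
Qed.

Lemma half_integrand_exp (X al eta th phi y : R) : 0 < eta ->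
  half_integrand X al (ln eta) th phi y = exp y * half_density X al eta th phi (exp y).
Proof.
intros e0; unfold half_integrand, half_density.
rewrite abspow_exp, (exp_plus (al * y)), exp_ln by easy.
unfold Rminus at 1; rewrite (exp_plus y), (Rmult_comm (exp (al * y)) eta); ring.
Qed.

Notation is_RInt_half f l := (is_RInt_gen f (at_point 0) (Rbar_locally p_infty) l).

(** The integral in b starts at the point 0 itself, which no finite y reaches. The missing piece
    from 0 to [exp y] is at most [exp y], the integrand being bounded by 1. *)
Lemma is_RInt_half_density (X al eta th phi L : R) : 1 < al -> 0 < eta -> 0 <= cos th ->
  is_RInt_line (half_integrand X al (ln eta) th phi) L ->
  is_RInt_half (half_density X al eta th phi) L.
Proof.
intros al1 e0 c0 H.
set (h := half_density X al eta th phi).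
assert (ch : forall b, continuous h b) by (intros b; now apply half_density_continuous).
assert (hb : forall b, Rabs (h b) <= 1) by (intros b; now apply half_density_bound).
assert (eH : forall y, half_integrand X al (ln eta) th phi y = exp y * h (exp y))
  by (intros y; now apply half_integrand_exp).
intros P [eps HP].
assert (e2 : 0 < eps / 2) by (generalize (cond_pos eps); lra).
destruct (H (ball L (mkposreal _ e2))) as [Q1 Q2 [A HA] [B HB] HQ].
{ now exists (mkposreal _ e2). }
apply Filter_prod with (fun a => a = 0) (fun b => exp B < b); [reflexivity | now exists (exp B) |].
intros a b -> hb'.
exists (RInt h 0 b); split.
{ apply (RInt_correct (V := R_CompleteNormedModule)); now apply ex_RInt_continuous_all. }
apply HP; change (Rabs (RInt h 0 b - L) < eps).
assert (b0 : 0 < b) by (generalize (exp_pos B); lra).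
(* Far enough left for two purposes: inside the neighbourhood of minus infinity given by [A], and
   with [exp y] at most eps / 4. *)
pose (y := Rmin (A - 1) (ln (eps / 4))).
assert (ey : exp y < eps / 2).
{ apply Rle_lt_trans with (exp (ln (eps / 4))); [apply exp_le, Rmin_r|].
  rewrite exp_ln by lra; lra. }
destruct (HQ y (ln b)) as [z [Hz1 Hz2]].
- apply HA; apply Rle_lt_trans with (1 := Rmin_l _ _); lra.
- apply HB; rewrite <- (ln_exp B); apply ln_increasing; [apply exp_pos | easy].
- simpl in Hz1; change (Rabs (z - L) < eps / 2) in Hz2.
  assert (E : z = RInt h (exp y) b).
  { rewrite <- (exp_ln b) by easy.
    rewrite <- (is_RInt_unique (V := R_CompleteNormedModule) _ _ _ _ Hz1).
    apply (is_RInt_unique (V := R_CompleteNormedModule)).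
    apply (is_RInt_ext (V := R_NormedModule)) with (fun y => scal (exp y) (h (exp y))).
    - intros x _; now rewrite eH.
    - apply (is_RInt_comp (V := R_CompleteNormedModule)); [intros; apply ch|].
      intros x _; split; [auto_derive; auto; ring | apply continuous_exp]. }
  assert (C : RInt h 0 b = RInt h 0 (exp y) + z).
  { rewrite E; symmetry.
    apply (RInt_Chasles (V := R_CompleteNormedModule)); now apply ex_RInt_continuous_all. }
  assert (S : Rabs (RInt h 0 (exp y)) <= (exp y - 0) * 1).
  { apply abs_RInt_le_const; [apply Rlt_le, exp_pos | now apply ex_RInt_continuous_all | intros; apply hb]. }
  rewrite C; replace (RInt h 0 (exp y) + z - L) with (RInt h 0 (exp y) + (z - L)) by ring.
  apply Rle_lt_trans with (1 := Rabs_triang _ _); lra.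
Qed.

Lemma is_RInt_half_reflect (f : R -> R) (L : R) :
  is_RInt_half f L ->
  is_RInt_gen (fun b => f (- b)) (Rbar_locally m_infty) (at_point 0) L.
Proof.
intros H P HP; destruct (H P HP) as [Q1 Q2 h1 [B HB] HQ].
apply Filter_prod with (fun a => a < - B) (fun b => b = 0); [now exists (- B) | reflexivity |].
intros a b ha ->.
destruct (HQ 0 (- a) h1) as [z [Hz Pz]]; [apply HB; lra|].
exists z; split; [|exact Pz]; simpl in *.
apply (is_RInt_swap (V := R_NormedModule)) in Hz.
rewrite <- Ropp_0 in Hz at 1.
apply (is_RInt_comp_opp (V := R_NormedModule)) in Hz.
apply (is_RInt_opp (V := R_NormedModule)) in Hz.
unfold opp in Hz; simpl in Hz; rewrite Ropp_involutive in Hz.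
apply (is_RInt_ext (V := R_NormedModule)) with (2 := Hz).
intros; now rewrite Ropp_involutive.
Qed.

Lemma is_RInt_gen_C_pair (f : R -> C) (Fa Fb : (R -> Prop) -> Prop) (l1 l2 : R) :
  Filter Fa -> Filter Fb ->
  is_RInt_gen (fun b => fst (f b)) Fa Fb l1 -> is_RInt_gen (fun b => snd (f b)) Fa Fb l2 ->
  is_RInt_gen (V := C_R_NormedModule) f Fa Fb (l1, l2).
Proof.
intros FFa FFb H1 H2 P [eps HP].
assert (h1 := H1 (ball l1 eps) (ex_intro _ eps (fun y hy => hy))).
assert (h2 := H2 (ball l2 eps) (ex_intro _ eps (fun y hy => hy))).
unfold filtermapi in h1, h2 |- *.
generalize (filter_and (F := filter_prod Fa Fb) _ _ h1 h2); apply filter_imp.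
intros ab [[z1 [I1 B1]] [z2 [I2 B2]]]; exists (z1, z2); split.
- now apply (is_RInt_fct_extend_pair (U := R_NormedModule) (V := R_NormedModule)).
- apply HP; now split.
Qed.

(** * The stable density *)

Definition stable_integrand (alpha x gam eta b : R) : C :=
  Cmult (cexp (0, - b * x))
    (cexp (Copp (Cmult (RtoC (eta * abspow b alpha)) (cexp (0, - (PI * gam / 2) * sgn b))))).

Lemma cexp_imaginary (w : R) : cexp (0, w) = (cos w, sin w).
Proof. unfold cexp, Re, Im; simpl; rewrite exp_0; f_equal; ring. Qed.

Lemma stable_integrand_polar (alpha x gam eta b w : R) :
  - (PI * gam / 2) * sgn b = w ->
  stable_integrand alpha x gam eta b =
  (exp (- (cos w * (eta * abspow b alpha))) * cos (- (sin w * (eta * abspow b alpha)) - b * x),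
   exp (- (cos w * (eta * abspow b alpha))) * sin (- (sin w * (eta * abspow b alpha)) - b * x)).
Proof.
intros e; unfold stable_integrand; rewrite e, !cexp_imaginary.
set (r := eta * abspow b alpha).
unfold cexp, Cmult, Copp, Re, Im, RtoC; simpl.
replace (- (r * cos w - 0 * sin w)) with (- (cos w * r)) by ring.
replace (- (r * sin w + 0 * cos w)) with (- (sin w * r)) by ring.
set (E := exp _); unfold Rminus; rewrite cos_plus, sin_plus.
replace (- (b * x)) with (- b * x) by ring.
f_equal; ring.
Qed.

(** Writing the sine as a cosine of phase shifted by - PI / 2 lets the single family [half_density]
    carry both components. *)
Lemma stable_integrand_pos (alpha x gam eta b : R) : 0 < b ->
  stable_integrand alpha x gam eta b =
  (half_density x alpha eta (PI * gam / 2) 0 b, half_density x alpha eta (PI * gam / 2) (- (PI / 2)) b).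
Proof.
intros b0; rewrite (stable_integrand_polar _ _ _ _ _ (- (PI * gam / 2))).
- rewrite cos_neg, sin_neg; unfold half_density.
  set (r := eta * abspow b alpha); f_equal; f_equal.
  + f_equal; ring.
  + rewrite <- cos_shift, <- cos_neg; f_equal; ring.
- unfold sgn; destruct (Req_EM_T b 0) as [h|_]; [lra|].
  rewrite Rabs_pos_eq by lra; field; lra.
Qed.

Lemma stable_integrand_neg (alpha x gam eta b : R) : b < 0 ->
  stable_integrand alpha x gam eta b =
  (half_density x alpha eta (PI * gam / 2) 0 (- b), - half_density x alpha eta (PI * gam / 2) (- (PI / 2)) (- b)).
Proof.
intros b0; rewrite (stable_integrand_polar _ _ _ _ _ (PI * gam / 2)).
- unfold half_density.
  replace (abspow (- b) alpha) with (abspow b alpha).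
  2: { unfold abspow; destruct (Req_EM_T b 0) as [h|_]; [lra|].
       destruct (Req_EM_T (- b) 0) as [h|_]; [lra|]; now rewrite Rabs_Ropp. }
  set (r := eta * abspow b alpha); f_equal.
  + f_equal; rewrite <- cos_neg; f_equal; ring.
  + rewrite (Ropp_mult_distr_r (exp _)); f_equal.
    rewrite <- (cos_neg (- (PI / 2) + _ - _)).
    replace (- (- (PI / 2) + sin (PI * gam / 2) * r - x * - b))
      with (PI / 2 - (sin (PI * gam / 2) * r + b * x)) by ring.
    rewrite cos_shift, <- sin_neg; f_equal; ring.
- unfold sgn; destruct (Req_EM_T b 0) as [h|_]; [lra|].
  rewrite Rabs_left by lra; field; lra.
Qed.

(** The integrand at -b is the conjugate of the one at b, so the half-lines contribute (l, m) and
    (l, - m): the real parts add to 2 l and the imaginary parts cancel. *)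
Lemma stable_density_half (alpha x gam eta l m : R) :
  is_RInt_half (half_density x alpha eta (PI * gam / 2) 0) l ->
  is_RInt_half (half_density x alpha eta (PI * gam / 2) (- (PI / 2))) m ->
  stable_density alpha x gam eta = RtoC (l / PI).
Proof.
intros H0 H1; assert (P := PI_RGT_0).
assert (Hp : is_RInt_gen (V := C_R_NormedModule) (stable_integrand alpha x gam eta) (at_point 0) (Rbar_locally p_infty) (l, m)).
{ apply is_RInt_gen_C_pair; try typeclasses eauto.
  - apply (is_RInt_gen_ext (V := R_NormedModule)) with (2 := H0).
    apply Filter_prod with (fun a => a = 0) (fun b => 0 < b); [reflexivity | now exists 0 |].
    intros a b -> b0 y hy; rewrite Rmin_left, Rmax_right in hy by (simpl; lra).
    now rewrite stable_integrand_pos by apply hy.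
  - apply (is_RInt_gen_ext (V := R_NormedModule)) with (2 := H1).
    apply Filter_prod with (fun a => a = 0) (fun b => 0 < b); [reflexivity | now exists 0 |].
    intros a b -> b0 y hy; rewrite Rmin_left, Rmax_right in hy by (simpl; lra).
    now rewrite stable_integrand_pos by apply hy. }
assert (Hm : is_RInt_gen (V := C_R_NormedModule) (stable_integrand alpha x gam eta) (Rbar_locally m_infty) (at_point 0) (l, - m)).
{ apply is_RInt_half_reflect in H0; apply is_RInt_half_reflect in H1.
  apply (is_RInt_gen_opp (V := R_NormedModule)) in H1.
  apply is_RInt_gen_C_pair; try typeclasses eauto.
  - apply (is_RInt_gen_ext (V := R_NormedModule)) with (2 := H0).
    apply Filter_prod with (fun a => a < 0) (fun b => b = 0); [now exists 0 | reflexivity |].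
    intros a b a0 -> y hy; rewrite Rmin_left, Rmax_right in hy by (simpl; lra).
    now rewrite stable_integrand_neg by apply hy.
  - apply (is_RInt_gen_ext (V := R_NormedModule)) with (2 := H1).
    apply Filter_prod with (fun a => a < 0) (fun b => b = 0); [now exists 0 | reflexivity |].
    intros a b a0 -> y hy; rewrite Rmin_left, Rmax_right in hy by (simpl; lra).
    now rewrite stable_integrand_neg by apply hy. }
assert (H := is_RInt_gen_Chasles (V := C_R_NormedModule) _ _ _ _ Hm Hp).
unfold stable_density; fold (stable_integrand alpha x gam eta).
rewrite (is_RInt_gen_unique (V := C_R_CompleteNormedModule) _ _ H).
unfold Cmult, RtoC; simpl; unfold plus; simpl; f_equal; field; lra.
Qed.

(** With s = nu (k + 1) / 2 the angle is PI s - k PI - PI / 2. Each half-turn flips a sign, and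
    these signs match the powers of -|x| in the solution. *)
Lemma cos_stable_phase (nu : R) (k : nat) :
  cos ((INR k + 1) * (PI * (nu - 1) / 2) - INR k * (PI / 2)) =
  (-1) ^ k * sin (PI * (nu * (INR k + 1) / 2)).
Proof.
replace ((INR k + 1) * (PI * (nu - 1) / 2) - INR k * (PI / 2))
  with (- (PI / 2 - (PI * (nu * (INR k + 1) / 2) - INR k * PI))) by field.
rewrite cos_neg, cos_shift.
set (u := PI * (nu * (INR k + 1) / 2)); clearbody u.
induction k as [|k IH].
- simpl; rewrite Rmult_0_l, Rminus_0_r; ring.
- rewrite S_INR; replace (u - (INR k + 1) * PI) with (- (PI - (u - INR k * PI))) by ring.
  rewrite sin_neg, sin_PI_x, IH; simpl; ring.
Qed.

(** The scale [eta] is kept general so that both equalities of the theorem are instances. *)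
Lemma stable_density_series (nu X eta : R) : 1 <= nu < 2 -> 0 <= X -> 0 < eta ->
  stable_density (2 / nu) X (2 / nu * (nu - 1)) eta =
  RtoC (nu / 2 * / Rpower eta (nu / 2) *
    Series (fun k => (- X / Rpower eta (nu / 2)) ^ k / INR (fact k)
      * rgamma (- nu * INR k / 2 + 1 - nu / 2))).
Proof.
intros hnu X0 e0; assert (P := PI_RGT_0).
set (th := PI * (2 / nu * (nu - 1)) / 2).
assert (al1 : 1 < 2 / nu).
{ apply Rmult_lt_reg_r with nu; [lra|]; unfold Rdiv; rewrite Rmult_assoc, Rinv_l; lra. }
assert (hth : 0 <= th < PI / 2).
{ unfold th; replace (PI * (2 / nu * (nu - 1)) / 2) with (PI * (nu - 1) / nu) by (field; lra).
  split.
  - apply Rmult_le_pos; [apply Rmult_le_pos; lra | apply Rlt_le, Rinv_0_lt_compat; lra].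
  - apply Rmult_lt_reg_r with nu; [lra|]; unfold Rdiv; rewrite (Rmult_assoc _ (/ nu)), Rinv_l by lra; nra. }
assert (c0 : 0 <= cos th) by (apply cos_ge_0; lra).
destruct (half_integrand_series X (2 / nu) (ln eta) th 0 X0 al1 hth) as [l [Hl1 Hl2]].
destruct (half_integrand_series X (2 / nu) (ln eta) th (- (PI / 2)) X0 al1 hth) as [m [_ Hm2]].
apply is_RInt_half_density in Hl2; try easy.
apply is_RInt_half_density in Hm2; try easy.
rewrite (stable_density_half _ _ _ _ l m) by easy; f_equal.
set (q := Rpower eta (nu / 2)).
assert (q0 : 0 < q) by apply exp_pos.
rewrite <- (is_series_unique _ _ Hl1).
unfold Rdiv at 1; rewrite <- Series_scal_r, <- Series_scal_l.
apply Series_ext; intros k; unfold series_term.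
assert (k0 := pos_INR k); assert (F := INR_fact_neq_0 k).
set (s := nu * (INR k + 1) / 2).
assert (s0 : 0 < s) by (unfold s; nra).
replace ((INR k + 1) / (2 / nu)) with s by (unfold s; field; lra).
replace (- nu * INR k / 2 + 1 - nu / 2) with (1 - s) by (unfold s; field).
rewrite rgamma_reflection by easy.
replace (s * th + 0 - INR k * (PI / 2)) with ((INR k + 1) * (PI * (nu - 1) / 2) - INR k * (PI / 2))
  by (unfold s, th; field; lra).
rewrite cos_stable_phase; fold s.
(* Since s = (k + 1) nu / 2, the power eta^(-s) consists of k + 1 factors [/ q]: one for the
   prefactor and k for the series variable. *)
replace (exp (- s * ln eta)) with (/ q * (/ q) ^ k).
2: { replace (/ q) with (exp (- (nu / 2 * ln eta))) by (unfold q, Rpower; apply exp_Ropp).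
     rewrite <- exp_INR_mul, <- exp_plus; f_equal; unfold s; field. }
replace (- X / q) with (-1 * X * / q) by (unfold Rdiv; ring).
rewrite !Rpow_mult_distr; field; repeat split; lra.
Qed.

Theorem theorem5p5 :
  forall (lam nu : R), 0 < lam -> 1 <= nu < 2 ->
  forall (x t : R), 0 < t ->
    RtoC (u_sol lam nu x t) =
      Cmult (RtoC (2 / nu * / (2 * lam * Rpower t (nu / 2))))
        (stable_density (2 / nu) (Rabs x / (lam * Rpower t (nu / 2)))
                        (2 / nu * (nu - 1)) 1)
    /\
    RtoC (u_sol lam nu x t) =
      Cmult (RtoC (1 / nu))
        (stable_density (2 / nu) (Rabs x) (2 / nu * (nu - 1))
                        (Rpower lam (2 / nu) * t)).
Proof.
intros lam nu lam0 hnu x t t0.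
set (T := Rpower t (nu / 2)); assert (T0 : 0 < T) by apply exp_pos.
assert (lT : 0 < lam * T) by now apply Rmult_lt_0_compat.
assert (L0 : 0 < Rpower lam (2 / nu)) by apply exp_pos.
split.
(* Here [eta = 1], and the scaling sits in the space argument. *)
- rewrite stable_density_series; try easy; [|apply Rmult_le_pos; [apply Rabs_pos | apply Rlt_le; now apply Rinv_0_lt_compat] | lra].
  rewrite <- RtoC_mult; f_equal; unfold u_sol; fold T.
  replace (Rpower 1 (nu / 2)) with 1 by (unfold Rpower; rewrite ln_1, Rmult_0_r; symmetry; apply exp_0).
  rewrite (Series_ext (fun k => (- (Rabs x / (lam * T)) / 1) ^ k / INR (fact k) * rgamma (- nu * INR k / 2 + 1 - nu / 2))
    (fun k => (- Rabs x / (lam * T)) ^ k / INR (fact k) * rgamma (- nu * INR k / 2 + 1 - nu / 2))).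
  + field; repeat split; lra.
  + intros k; do 3 f_equal; field; lra.
(* Here [eta] is lam^(2/nu) t, whose power nu / 2 is [lam * T], the scale in the solution. *)
- rewrite stable_density_series; try easy; [|apply Rabs_pos | now apply Rmult_lt_0_compat].
  rewrite <- RtoC_mult; f_equal; unfold u_sol; fold T.
  rewrite <- Rpower_mult_distr by easy; fold T; rewrite Rpower_mult.
  replace (2 / nu * (nu / 2)) with 1 by (field; lra); rewrite Rpower_1 by easy.
  field; repeat split; lra.
Qed.
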